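(* Let $G$ be a finite simple graph with at least three vertices that is isomorphic to $P_3(T)$ for some finite tree $T$. Then every finite simple graph $H$ having the same deck as $G$ is isomorphic to $G$; that is, the Reconstruction Conjecture holds for the class of graphs isomorphic to the cube of a tree.
   Context: For a graph $G$, its third power (cube) $P_3(G)$ is the graph on the same vertex set in which two distinct vertices are adjacent if and only if their distance in $G$ is at most $3$. A card of a finite graph $G$ is an unlabelled vertex-deleted subgraph $G-v$; the deck of $G$ is the multiset of (isomorphism classes of) all its cards, one for each vertex. The Reconstruction Conjecture asserts that every finite simple graph with at least three vertices is determined up to isomorphism by its deck. *)

(* Defs.v *)
From HB Require Import structures.
From mathcomp Require Import all_boot.

Set Implicit Arguments.
Unset Strict Implicit.
Unset Printing Implicit Defensive.

Record sgraph := SGraph {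
  vertex :> finType;
  adj : rel vertex;
  adj_sym : symmetric adj;
  adj_irr : irreflexive adj }.

Definition isomorphic (G H : sgraph) : bool :=
  [exists f : {ffun G -> H}, exists g : {ffun H -> G},
    [&& [forall x, g (f x) == x], [forall y, f (g y) == y]
      & [forall x, forall y, adj (f x) (f y) == adj x y]]].

Lemma isomorphicP (G H : sgraph) :
  reflect (exists2 f : G -> H, bijective f
             & forall x y, adj (f x) (f y) = adj x y)
          (isomorphic G H).
Proof.
apply: (iffP existsP) => [[f /existsP[g /and3P[/forallP fK /forallP gK]]]|].
  move=> /forallP fE; exists f.
    by exists g => [x|y]; apply/eqP.
  by move=> x y; apply/eqP; move/forallP: (fE x); apply.
case=> f [g fK gK] fE; exists [ffun x => f x].
apply/existsP; exists [ffun y => g y]; apply/and3P; split.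
- by apply/forallP=> x; rewrite !ffunE fK.
- by apply/forallP=> y; rewrite !ffunE gK.
- by apply/forallP=> x; apply/forallP=> y; rewrite !ffunE fE.
Qed.

Section VertexDeletion.
Variables (G : sgraph) (v : G).

Definition vdel_adj : rel {x : G | x != v} := relpre val (@adj G).

Lemma vdel_sym : symmetric vdel_adj.
Proof. by move=> x y; apply: adj_sym. Qed.

Lemma vdel_irr : irreflexive vdel_adj.
Proof. by move=> x; apply: adj_irr. Qed.

Definition vdel : sgraph := SGraph vdel_sym vdel_irr.

End VertexDeletion.

(* The deck is a multiset of isomorphism classes, represented by its
   multiplicity function: deck G K is the number of vertices v for which the
   card G - v belongs to the isomorphism class of K. *)
Definition deck (G K : sgraph) : nat := #|[set v : G | isomorphic (vdel v) K]|.

Definition same_deck (G H : sgraph) : Prop := deck G =1 deck H.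

Section Distance.
Variable G : sgraph.

Definition walk (n : nat) (x y : G) : bool :=
  [exists p : n.-tuple G, path (@adj G) x p && (last x p == y)].

(* None is the infinite distance. Restricting to lengths below #|G| loses
   nothing, since a shortest walk repeats no vertex; see dist_SomeP. *)
Definition dist (x y : G) : option nat :=
  let d := find (fun n => walk n x y) (iota 0 #|G|) in
  if d < #|G| then Some d else None.

Lemma walk_short n x y : walk n x y -> exists2 m, m <= n & walk m x y && (m < #|G|).
Proof.
case/existsP=> p /andP[xp /eqP py].
case/shortenP: xp py => q xq uq sq qy.
exists (size q).
  rewrite -(size_tuple p); apply: uniq_leq_size => //; first by case/andP: uq.
apply/andP; split.
  by apply/existsP; exists (in_tuple q); rewrite /= xq qy eqxx.
by have := max_card [in x :: q]; rewrite (card_uniqP uq).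
Qed.

Lemma dist_SomeP x y d :
  dist x y = Some d <-> walk d x y /\ forall n, walk n x y -> d <= n.
Proof.
rewrite /dist; set a := fun n => walk n x y; set s := iota 0 #|G|.
have szs : size s = #|G| by rewrite size_iota.
have min n : a n -> find a s <= n /\ find a s < #|G|.
  move=> /walk_short[m le_mn /andP[am lt_m]].
  have le_fm : find a s <= m.
    rewrite leqNgt; apply/negP=> /(before_find 0).
    by rewrite nth_iota // add0n /a am.
  by split; [apply: leq_trans le_mn | apply: leq_ltn_trans lt_m].
have af : find a s < #|G| -> a (find a s).
  move=> lt_f; have := lt_f; rewrite -{1}szs -has_find => /(nth_find 0).
  by rewrite nth_iota.
split=> [|[ad dmin]].
  case: ifP => // lt_f [<-]; split; first exact: af.
  by move=> n /min[].
have [le_fd lt_f] := min _ ad; rewrite lt_f; congr Some.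
by apply/eqP; rewrite eqn_leq le_fd dmin //; apply: af.
Qed.

Lemma walk_sym n x y : walk n x y = walk n y x.
Proof.
suff W u v : walk n u v -> walk n v u by apply/idP/idP; apply: W.
case/existsP=> p /andP[up /eqP <-].
have sz : size (rev (belast u p)) == n by rewrite size_rev size_belast size_tuple.
apply/existsP; exists (Tuple sz) => /=; rewrite rev_path.
rewrite (eq_path (e' := @adj G)) ?up /=; last by move=> ? ?; rewrite adj_sym.
by case: (tval p) => [|z q] //=; rewrite rev_cons last_rcons.
Qed.

Lemma dist_sym x y : dist x y = dist y x.
Proof. by rewrite /dist (eq_find (fun n => walk_sym n x y)). Qed.

End Distance.

Section Power.
Variables (k : nat) (G : sgraph).

Definition power_adj : rel G :=
  fun x y => (x != y) && (if dist x y is Some d then d <= k else false).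

Lemma power_sym : symmetric power_adj.
Proof. by move=> x y; rewrite /power_adj eq_sym dist_sym. Qed.

Lemma power_irr : irreflexive power_adj.
Proof. by move=> x; rewrite /power_adj eqxx. Qed.

Definition power : sgraph := SGraph power_sym power_irr.

End Power.

Definition connected (G : sgraph) : Prop :=
  0 < #|G| /\ forall x y : G, connect (@adj G) x y.

(* A walk back and forth along an edge is a ucycle of size 2, so graph cycles
   are the ucycles of size at least 3. *)
Definition acyclic (G : sgraph) : Prop :=
  forall c : seq G, ucycle (@adj G) c -> size c <= 2.

Definition tree (G : sgraph) : Prop := connected G /\ acyclic G.

(* Main.v *)
Require Import Defs.
From mathcomp Require Import all_boot fingroup perm zify.

(* The path metric of a tree is characterised by the four-point condition, a parity
   condition and the existence of geodesics, so a graph is the cube of a tree if and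
   only if its closed adjacency is [d x y <= 3] for such a metric [d]. By Kelly's
   lemma the deck of [G] fixes the degree of the vertex missing from a card, and
   whether it is simplicial.

   If [d] has diameter at most 6, a centre is adjacent to all other vertices, and
   knowing the card at that centre and its degree is enough. Otherwise [H] is first
   shown to be the cube of a tree: two cards of [H] missing nonadjacent simplicial
   vertices [w] and [u] are cubes with metrics [S] and [T], and [T] tells where the
   leaf [w] has to be attached to the tree of [S]. Then consider the card missing
   the vertex [x] at distance 2 from an end of a diametral path of [d]. The metrics
   of [G] and [H] have the same cube off [x], with equally large neighbourhoods of
   [x]; this forces the balls of radius 1, 2, 4 and 5 about [x] to agree, and the
   vertices in which the balls of radius 3 differ are pairwise twins, so that they
   can be exchanged. *)

Set Implicit Arguments.
Unset Strict Implicit.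
Unset Printing Implicit Defensive.

(** * Tree metrics *)

(** The obstacle is that a cube does not determine its tree: swapping twins already changes the
    metric and not the cube. Metrics obtained from different cards are therefore never identified;
    only what the cube shows of them is compared, chiefly the common neighbours of two vertices at
    distance 4, which form the closed neighbourhood (the star) of their midpoint. A metric lives on
    a subset [A] because a card misses a vertex; a simplicial vertex that does not dominate is a
    leaf, and deleting it leaves a tree metric.

    Distance 2 from the end makes [x] the midpoint of that end and of a vertex at distance 4, so its
    star is visible in the card, and it keeps every branch at [x] other than the one towards the far
    end within depth 2. The bound 6 is twice the exponent 3. At diameter 7 the path is too short for
    some distance arguments, and comparing the branches near its two ends replaces them. *)

(* [d] is the path metric of a tree with vertex set [A]; its values off [A] are junk. *)
Record tmetric (V : finType) (A : {pred V}) (d : V -> V -> nat) : Prop := TMetric {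
  tm0 : forall x y, x \in A -> y \in A -> (d x y == 0) = (x == y);
  tmC : forall x y, x \in A -> y \in A -> d x y = d y x;
  tmP : forall x y z, x \in A -> y \in A -> z \in A -> ~~ odd (d x y + d y z + d x z);
  tm4 : forall x y z t, x \in A -> y \in A -> z \in A -> t \in A ->
    d x y + d z t <= maxn (d x z + d y t) (d x t + d y z);
  tmG : forall x y k, x \in A -> y \in A -> k <= d x y ->
    exists z, [/\ z \in A, d x z = k & d z y = d x y - k] }.

(** The witnesses are Gromov products, integral by parity: [p] measures from [x] to its branch
    point, [r] from [z] to its own, and [m] is what remains of [xz]. *)
Lemma quad_arith xy zt xz yt xt yz : xy + zt <= xz + yt -> xz + yt = xt + yz ->
  ~~ odd (xy + yz + xz) -> ~~ odd (xz + zt + xt) -> ~~ odd (xy + yt + xt) ->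
  xy <= xz + yz -> yz <= xy + xz -> xz <= xy + yz -> zt <= xz + xt -> xt <= xz + zt ->
  xz <= xt + zt ->
  exists p q r s m, [/\ xy = p + q, zt = r + s, xz = p + m + r, xt = p + m + s &
    yz = q + m + r /\ yt = q + m + s].
Proof.
move=> *; exists ((xy + xz - yz) %/ 2), (xy - (xy + xz - yz) %/ 2), ((zt + xz - xt) %/ 2),
  (zt - (zt + xz - xt) %/ 2), (xz - (xy + xz - yz) %/ 2 - (zt + xz - xt) %/ 2).
split; try split; lia.
Qed.

Section TMetricBasics.
Variables (V : finType) (A : {pred V}) (d : V -> V -> nat).
Hypothesis H : tmetric A d.

Lemma tmxx x : x \in A -> d x x = 0.
Proof. by move=> xA; apply/eqP; rewrite (tm0 H). Qed.

Lemma tm_eq x y : x \in A -> y \in A -> d x y = 0 -> x = y.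
Proof. by move=> xA yA /eqP; rewrite (tm0 H) // => /eqP. Qed.

Lemma tm_tri x y z : x \in A -> y \in A -> z \in A ->
  [/\ ~~ odd (d x y + d y z + d x z), d x y <= d x z + d y z,
      d x z <= d x y + d y z & d y z <= d x y + d x z].
Proof.
move=> xA yA zA; have tr a b c : a \in A -> b \in A -> c \in A -> d a b <= d a c + d b c.
  move=> aA bA cA; have := tm4 H aA bA cA cA; rewrite tmxx //; lia.
split; first exact: (tmP H).
- exact: tr.
- by rewrite (tmC H yA) //; apply: tr.
- by rewrite (tmC H xA yA) // (tmC H xA zA) //; apply: tr.
Qed.

Lemma tm_tripod x y z : x \in A -> y \in A -> z \in A ->
  exists p q r, [/\ d x y = p + q, d x z = p + r & d y z = q + r].
Proof.
move=> xA yA zA; have [od t1 t2 t3] := tm_tri xA yA zA.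
exists ((d x y + d x z - d y z) %/ 2), ((d x y + d y z - d x z) %/ 2),
  ((d x z + d y z - d x y) %/ 2); split; lia.
Qed.

(* The four points span an H-shaped tree, with legs [p], [q], [r], [s] and bar [m]. *)
Lemma tm_quad x y z t : x \in A -> y \in A -> z \in A -> t \in A ->
  exists p q r s m,
  [\/ [/\ d x y = p + q, d z t = r + s, d x z = p + m + r, d x t = p + m + s &
           d y z = q + m + r /\ d y t = q + m + s],
      [/\ d x z = p + q, d y t = r + s, d x y = p + m + r, d x t = p + m + s &
           d y z = q + m + r /\ d z t = q + m + s] |
      [/\ d x t = p + q, d y z = r + s, d x y = p + m + r, d x z = p + m + s &
           d y t = q + m + r /\ d z t = q + m + s]].
Proof.
move=> xA yA zA tA.
have h1 := tm4 H xA yA zA tA; have h2 := tm4 H xA zA yA tA.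
have h3 := tm4 H xA tA yA zA.
have e1 := tmC H yA zA; have e2 := tmC H tA zA; have e3 := tmC H tA yA.
rewrite e2 e3 -?e1 in h1 h2 h3.
have [o1 t1 t2 t3] := tm_tri xA yA zA; have [o2 t4 t5 t6] := tm_tri xA yA tA.
have [o3 t7 t8 t9] := tm_tri xA zA tA; have [o4 t10 t11 t12] := tm_tri yA zA tA.
have [[g1 g2]|[[g1 g2]|[g1 g2]]] :
    d x y + d z t <= d x z + d y t /\ d x z + d y t = d x t + d y z \/
    d x z + d y t <= d x y + d z t /\ d x y + d z t = d x t + d y z \/
    d x t + d y z <= d x y + d z t /\ d x y + d z t = d x z + d y t.
- clear -h1 h2 h3; lia.
- have [p [q [r [s [m h]]]]] : exists p q r s m, [/\ d x y = p + q, d z t = r + s,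
      d x z = p + m + r, d x t = p + m + s & d y z = q + m + r /\ d y t = q + m + s].
    by apply: quad_arith => //; lia.
  by exists p, q, r, s, m; apply: Or31.
- have [p [q [r [s [m h]]]]] : exists p q r s m, [/\ d x z = p + q, d y t = r + s,
      d x y = p + m + r, d x t = p + m + s & d y z = q + m + r /\ d z t = q + m + s].
    by apply: quad_arith => //; lia.
  by exists p, q, r, s, m; apply: Or32.
- have [p [q [r [s [m h]]]]] : exists p q r s m, [/\ d x t = p + q, d y z = r + s,
      d x y = p + m + r, d x z = p + m + s & d y t = q + m + r /\ d z t = q + m + s].
    by apply: quad_arith => //; lia.
  by exists p, q, r, s, m; apply: Or33.
Qed.

End TMetricBasics.

(* [tri] and [quad] express the distances among three or four points by the edge
   lengths of the tree they span; [geo H x y k z] picks [z] at distance [k] from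
   [x] on the geodesic to [y], leaving facts named [zA], [dz] and [dz0]. *)
Ltac tmin := first [assumption | done].
Ltac sym2 H x y := let h := fresh "sy" in
  pose proof (@tmC _ _ _ H x y ltac:(tmin) ltac:(tmin)) as h.
Ltac tri H x y z :=
  let a := fresh "tr" in let b := fresh "tr" in let c := fresh "tr" in
  let p := fresh "p" in let q := fresh "q" in let r := fresh "r" in
  destruct (@tm_tripod _ _ _ H x y z ltac:(tmin) ltac:(tmin) ltac:(tmin)) as [p [q [r [a b c]]]];
  sym2 H x y; sym2 H y z; sym2 H x z.
Ltac quad H x y z t :=
  let p := fresh "p" in let q := fresh "q" in let r := fresh "r" in let s := fresh "s" in
  let m := fresh "m" in
  let h1 := fresh "h" in let h2 := fresh "h" in let h3 := fresh "h" in
  let h4 := fresh "h" in let h5 := fresh "h" in let h6 := fresh "h" in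
  sym2 H x y; sym2 H x z; sym2 H x t; sym2 H y z; sym2 H y t; sym2 H z t;
  destruct (@tm_quad _ _ _ H x y z t ltac:(tmin) ltac:(tmin) ltac:(tmin) ltac:(tmin))
    as [p [q [r [s [m [[h1 h2 h3 h4 [h5 h6]]|[h1 h2 h3 h4 [h5 h6]]|[h1 h2 h3 h4 [h5 h6]]]]]]]].
(* [lia] splits on every boolean atom of the context: drop those that are not arithmetic. *)
Ltac tlia := repeat match goal with
  | h : is_true (negb (eq_op _ _)) |- _ => clear h
  | h : context [#|_|] |- _ => clear h
  | h : forall _ : _, _ |- _ => clear h
  | h : tmetric _ _ |- _ => clear h
  | h : is_true (in_mem _ _) |- _ => clear h
  | h : is_true (negb (?f _ _)) |- _ => is_var f; clear h
  end; lia.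
Ltac geo H x y k z :=
  let a := fresh "zA" in let b := fresh "dz" in let c := fresh "dz" in
  destruct (@tmG _ _ _ H x y k ltac:(tmin) ltac:(tmin) ltac:(tlia)) as [z [a b c]].

(** * Gluing and transporting tree metrics *)

(** Geodesic convexity of [B] is what keeps [tmG]; the other fields are universal and pass to any
    subset. *)
Lemma sub_tmetric (V : finType) (A B : {pred V}) (d : V -> V -> nat) :
    tmetric A d -> {subset B <= A} ->
    (forall x y z, x \in B -> y \in B -> z \in A -> d x z + d z y = d x y -> z \in B) ->
  tmetric B d.
Proof.
move=> H sBA cv; split.
- by move=> x y /sBA xA /sBA yA; apply: tm0 H _ _ xA yA.
- by move=> x y /sBA xA /sBA yA; apply: tmC H _ _ xA yA.
- by move=> x y z /sBA xA /sBA yA /sBA zA; apply: tmP H _ _ _ xA yA zA.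
- by move=> x y z t /sBA xA /sBA yA /sBA zA /sBA tA; apply: (tm4 H xA yA zA tA).
- move=> x y k xB yB lek; have [z [zA h1 h2]] := tmG H (sBA _ xB) (sBA _ yB) lek.
  by exists z; split=> //; apply: (cv x y) => //; tlia.
Qed.

Lemma perm_tmetric (V W : finType) (A : {pred W}) (B : {pred V}) (s : V -> W) (s' : W -> V)
    (d : W -> W -> nat) :
  cancel s s' -> cancel s' s -> (forall x, (s x \in A) = (x \in B)) ->
  tmetric A d -> tmetric B (fun x y => d (s x) (s y)).
Proof.
move=> sK s'K sA H; split; try by move=> *;
  (apply: tmC H _ _ _ _ || apply: tmP H _ _ _ _ _ _ || apply: tm4 H _ _ _ _ _ _ _ _); rewrite sA.
  by move=> x y xB yB; rewrite (tm0 H) ?sA // (can_eq sK).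
move=> x y k xB yB lek; have [||z [zA h1 h2]] := tmG H (x := s x) (y := s y) _ _ lek; rewrite ?sA //.
by exists (s' z); rewrite -sA s'K; split.
Qed.

(** The metric after a pendant vertex [w] is hung on [p]; the junk values of [d] at [w] are
    overwritten. *)
Definition leaf_ext (V : eqType) (w p : V) (d : V -> V -> nat) (x y : V) : nat :=
  if x == w then if y == w then 0 else (d p y).+1 else if y == w then (d x p).+1 else d x y.

Lemma leaf_ext_tmetric (V : finType) (A B : {pred V}) (w p : V) (d : V -> V -> nat) :
    tmetric A d -> p \in A -> w \notin A -> (forall x, (x \in B) = (x == w) || (x \in A)) ->
  tmetric B (leaf_ext w p d).
Proof.
move=> H pA wA BE.
have nw x : x \in A -> (x == w) = false by move=> xA; apply: contraNF wA => /eqP <-.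
have pp := tmxx H pA.
split.
- move=> x y; rewrite !BE /leaf_ext => /orP[/eqP->|xA] /orP[/eqP->|yA]; rewrite ?eqxx ?nw //.
  + by rewrite [RHS]eq_sym nw.
  + exact: tm0 H _ _ xA yA.
- move=> x y; rewrite !BE /leaf_ext => /orP[/eqP->|xA] /orP[/eqP->|yA]; rewrite ?eqxx ?nw //.
  + by rewrite (tmC H).
  + by rewrite (tmC H).
  + by rewrite (tmC H).
- move=> x y z; rewrite !BE /leaf_ext => /orP[/eqP->|xA] /orP[/eqP->|yA] /orP[/eqP->|zA];
    rewrite ?eqxx ?nw //.
  all: try (sym2 H y p); try (sym2 H z p); try (sym2 H x p); try tri H x y p; try tri H x z p;
    try tri H y z p; try tri H x y z; try tlia.
- move=> x y z t; rewrite !BE /leaf_ext => /orP[/eqP->|xA] /orP[/eqP->|yA] /orP[/eqP->|zA] /orP[/eqP->|tA];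
    rewrite ?eqxx ?nw //.
  all: try exact: (tm4 H).
  all: try by have := tm4 H pA yA zA tA; tlia.
  all: try by have := tm4 H xA pA zA tA; sym2 H p z; sym2 H p t; tlia.
  all: try by have := tm4 H xA yA pA tA; sym2 H p t; tlia.
  all: try by have := tm4 H xA yA zA pA; sym2 H p z; tlia.
  all: try (tri H x y p); try (tri H x z p); try (tri H x t p); try (tri H y z p); try (tri H y t p);
    try (tri H z t p); try (sym2 H y p); try (sym2 H z p); try (sym2 H x p); try (sym2 H t p); try tlia.
- move=> x y k; rewrite !BE => /orP[/eqP->|xA] /orP[/eqP->|yA]; rewrite /leaf_ext ?eqxx ?nw //.
  + by rewrite leqn0 => /eqP->; exists w; rewrite BE !eqxx.
  + case: k => [_|k lek]; first by exists w; rewrite BE !eqxx ?nw // subn0.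
    geo H p y k z; exists z; rewrite BE zA orbT ?nw //; split=> //; tlia.
  + case: (ltnP (d x p) k) => h lek.
      by exists w; rewrite BE !eqxx; split=> //; tlia.
    geo H x p k z; exists z; rewrite BE zA orbT ?nw //; split=> //; tlia.
  + by move=> lek; geo H x y k z; exists z; rewrite BE zA orbT ?nw.
Qed.

(** * Leaves and stars seen through the cube *)

Lemma simplicial_leaf (V : finType) (A : {pred V}) (d : V -> V -> nat) (u z : V) :
    tmetric A d -> u \in A -> z \in A -> 4 <= d u z ->
    (forall y t, y \in A -> t \in A -> d u y <= 3 -> d u t <= 3 -> d y t <= 3) ->
  exists p, [/\ p \in A, d u p = 1 & forall y, y \in A -> y != u -> d u y = (d p y).+1].
Proof.
move=> H uA zA uz cl; geo H u z 1 p; exists p; split=> // y yA yu.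
have uy : 0 < d u y by rewrite lt0n (tm0 H) // eq_sym.
geo H u y 1 q; geo H p z 2 t.
have h1 : d u t = 3 by tri H u p t; tri H u t z; tlia.
have h2 := cl q t zA1 zA2 ltac:(tlia) ltac:(tlia).
(* [t] lies 3 steps from [u] towards [z]; a second neighbour [q] of [u] would be at distance 4 from
   [t], although [u] has both within 3. *)
suff E : p = q by rewrite E; tlia.
by apply: (tm_eq H) => //; quad H u p q t; tlia.
Qed.

(** Vertices 2 steps from [g] in different branches are 4 apart, so when the 2-ball of [g] is a
    clique of the cube only the branch of [h] goes deeper than 1. *)
Lemma leaf_direction (V : finType) (A : {pred V}) (d : V -> V -> nat) (g z h y : V) :
    tmetric A d -> g \in A -> z \in A -> h \in A -> y \in A -> 3 <= d g z ->
    (forall y t, y \in A -> t \in A -> d g y <= 2 -> d g t <= 2 -> d y t <= 3) ->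
    d g h = 1 -> d h z = d g z - 1 -> 2 <= d g y -> d h y = d g y - 1.
Proof.
move=> H gA zA hA yA gz cl gh hz gy; geo H g z 2 z2; geo H g y 2 y2.
have h1 := cl z2 y2 zA0 zA1 ltac:(tlia) ltac:(tlia).
have h2 : d h z2 = 1 by quad H g z h z2; tlia.
have h3 : d h y2 = 1 by quad H g h z2 y2; tlia.
by quad H g h y2 y; tlia.
Qed.

(** The right-hand side uses only the cube and the 2-ball of [g], so two metrics sharing these also
    share the star of [h]. A neighbour of [g] other than [h] is at least 4 away from any [t] with
    [3 <= d g t]. *)
Lemma second_ball (V : finType) (A : {pred V}) (d : V -> V -> nat) (g z h y : V) :
    tmetric A d -> g \in A -> z \in A -> h \in A -> y \in A -> 3 <= d g z ->
    (forall y t, y \in A -> t \in A -> d g y <= 2 -> d g t <= 2 -> d y t <= 3) ->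
    d g h = 1 -> d h z = d g z - 1 ->
  reflect (d g y <= 2 /\ exists t, [/\ t \in A, d y t <= 3 & 3 <= d g t]) (d h y <= 1).
Proof.
move=> H gA zA hA yA gz cl gh hz.
have dir t tA := leaf_direction H gA zA hA (y := t) tA gz cl gh hz.
apply: (iffP idP) => [h1|[h1 [t [tA h2 h3]]]].
  split; first by tri H g h y; tlia.
  geo H g z 3 t; have h2 := dir t zA0 ltac:(tlia).
  by exists t; split=> //; [tri H h y t; tlia | tlia].
have h4 := dir t tA ltac:(tlia).
have [h5|h5] := leqP 2 (d g y); first by have := dir y yA h5; tlia.
by quad H g h y t; tlia.
Qed.

(** Take [y3] at depth 3 towards [y] and [n] the neighbour of [h1] on the way: [y3] is within 3 of
    [h1] and [n] but not of [g]. All three lie in the star of [h2], where only one neighbour of [h2]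
    can be nearer to [y3] in [d2]; hence [n] is [h2] itself. *)
Lemma shifted_centre (V : finType) (A : {pred V}) (d1 d2 : V -> V -> nat) (h1 h2 g y : V) :
    tmetric A d1 -> tmetric A d2 ->
    {in A &, forall y t, (d1 y t <= 3) = (d2 y t <= 3)} ->
    h1 \in A -> h2 \in A -> g \in A -> y \in A -> h1 != h2 ->
    {in A, forall y, (d1 h1 y <= 1) = (d2 h2 y <= 1)} ->
    d1 h1 g = 1 -> d1 g y = (d1 h1 y).+1 -> 3 <= d1 h1 y ->
  d1 h1 h2 = 1 /\ d1 h2 y = d1 h1 y - 1.
Proof.
move=> H1 H2 K h1A h2A gA yA h12 B h1g gy h1y.
geo H1 h1 y 3 y3; geo H1 h1 y3 1 n.
have gy3 : d1 g y3 = 4 by quad H1 h1 y g y3; tlia.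
have k1 := K g y3 gA zA; have k2 := K n y3 zA0 zA; have k3 := K h1 y3 h1A zA.
have b1 := B g gA; have b2 := B n zA0; have b3 := B h1 h1A; rewrite (tmxx H1) // in b3.
have nh1 : 0 < d2 n h1 by rewrite lt0n (tm0 H2) // -(tm0 H1) // -lt0n (tmC H1) // dz1.
have hh : 0 < d2 h2 h1 by rewrite lt0n (tm0 H2) // eq_sym.
suff E : h2 = n by rewrite E; tri H1 n y3 y; tri H1 h1 n y; tlia.
apply: (tm_eq H2) => //.
by tri H2 g h2 y3; quad H2 h2 n h1 y3; tlia.
Qed.

(** If the branch had depth 4, [h2] would be the neighbour of [h1] towards [y4] and would have in
    [d2] a neighbour [n] nearer to [y4]. But [n] is in the star of [h1], where only [h2] comes
    within 3 of [y4]. *)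
Lemma shifted_centre_depth (V : finType) (A : {pred V}) (d1 d2 : V -> V -> nat) (h1 h2 g y : V) :
    tmetric A d1 -> tmetric A d2 ->
    {in A &, forall y t, (d1 y t <= 3) = (d2 y t <= 3)} ->
    h1 \in A -> h2 \in A -> g \in A -> y \in A -> h1 != h2 ->
    {in A, forall y, (d1 h1 y <= 1) = (d2 h2 y <= 1)} ->
    d1 h1 g = 1 -> d1 g y = (d1 h1 y).+1 -> d1 h1 y <= 3.
Proof.
move=> H1 H2 K h1A h2A gA yA h12 B h1g gy; rewrite leqNgt; apply/negP => h1y.
geo H1 h1 y 4 y4.
have gy4 : d1 g y4 = 5 by quad H1 h1 y g y4; tlia.
have [e1 e2] := shifted_centre H1 H2 K h1A h2A gA zA h12 B h1g ltac:(tlia) ltac:(tlia).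
have k1 := K h2 y4 h2A zA; have k2 := K h1 y4 h1A zA.
have b3 := B h1 h1A; rewrite (tmxx H1) // in b3.
have h2y4 : d2 h2 y4 = 3 by tri H2 h1 h2 y4; tlia.
geo H2 h2 y4 1 n; have b := B n zA0; have k := K n y4 zA0 zA.
suff E : n = h2 by move: dz1; rewrite E (tmxx H2).
by apply: (tm_eq H1) => //; quad H1 h1 y4 h2 n; tlia.
Qed.

(** * Gluing two metrics that each miss one vertex *)

Section Recognition.
Variables (V : finType) (k : rel V) (w u b : V) (S T : V -> V -> nat).
Hypotheses (krefl : reflexive k) (ksym : symmetric k).
Hypotheses (HS : tmetric (predC1 w) S) (HT : tmetric (predC1 u) T).
Hypothesis KS : forall y t, y != w -> t != w -> (S y t <= 3) = k y t.
Hypothesis KT : forall y t, y != u -> t != u -> (T y t <= 3) = k y t.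
Hypotheses (wu : w != u) (kwu : ~~ k w u).
Hypothesis simp_w : forall y t, k w y -> k w t -> k y t.
Hypothesis simp_u : forall y t, k u y -> k u t -> k y t.
Hypothesis nodom : forall h, exists y, ~~ k h y.
Hypothesis far_u : forall q, q != w -> k w q -> 2 <= S u q.
Hypothesis far_simp : forall q, q != w -> k w q ->
  (forall y t, y != w -> t != w -> k q y -> k q t -> k y t) -> 6 <= S u q.
Hypotheses (bw : b != w) (Sb : 6 <= S u b).
Hypothesis Smax : forall y t, y != w -> t != w -> S y t <= S u b.

Let A : {pred V} := [pred y | (y != w) && (y != u)].

Let uW : u \in predC1 w. Proof. by rewrite inE eq_sym. Qed.
Let wU : w \in predC1 u. Proof. by rewrite inE. Qed.
Let bW : b \in predC1 w. Proof. by rewrite inE. Qed.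
Let bu : b != u.
Proof. by apply/eqP => E; move: Sb; rewrite E (tmxx HS). Qed.
Let bA : b \in A. Proof. by rewrite inE bw bu. Qed.
Let AW y : y \in A -> y \in predC1 w. Proof. by rewrite !inE => /andP[]. Qed.
Let AU y : y \in A -> y \in predC1 u. Proof. by rewrite !inE => /andP[]. Qed.

(** A leaf hung on [p] has the 2-ball of [p] as its cube-neighbourhood. It remains to find a vertex
    whose 2-ball, in [S] or in a variant with the same cube, is the neighbourhood of [w]. *)
Let extend (S' : V -> V -> nat) p : tmetric (predC1 w) S' -> p \in A -> 3 <= S' p u ->
  (forall y t, y != w -> t != w -> (S' y t <= 3) = k y t) ->
  (forall y, y \in A -> k w y = (S' p y <= 2)) ->
  exists e, tmetric predT e /\ forall y t, (e y t <= 3) = k y t.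
Proof.
move=> H pA pu KS' kw; exists (leaf_ext w p S'); split.
  by apply: (leaf_ext_tmetric (w := w) H (AW pA)) => [|y]; rewrite !inE ?eqxx // orbN.
have kwE y : y != w -> (S' p y <= 2) = k w y.
  by move=> yw; have [->|yu] := eqVneq y u; [rewrite (negPf kwu); tlia | rewrite kw // inE yw].
move=> y t; rewrite /leaf_ext; have [->|yw] := eqVneq y w; have [->|tw] := eqVneq t w.
- by rewrite krefl.
- by rewrite ltnS kwE.
- by rewrite ltnS ksym -kwE // (tmC H) //; exact: AW.
- exact: KS'.
Qed.

Lemma glue_metrics : exists e, tmetric predT e /\ forall y t, (e y t <= 3) = k y t.
Proof.
have uw : u != w by rewrite eq_sym.
have [c [cW uc cP]] : exists c, [/\ c \in predC1 w, S u c = 1 &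
    forall y, y \in predC1 w -> y != u -> S u y = (S c y).+1].
  apply: (simplicial_leaf HS uW bW); first by tlia.
  move=> y t; rewrite !inE => yw tw; rewrite !KS //; exact: simp_u.
have cu : c != u by apply/eqP => E; move: uc; rewrite E (tmxx HS).
have cA : c \in A by rewrite inE cu andbT; move: cW; rewrite inE.
have ncw : ~~ k w c by apply/negP => /(far_u cW); rewrite uc.
have [p [pU wp pP]] : exists p, [/\ p \in predC1 u, T w p = 1 &
    forall y, y \in predC1 u -> y != w -> T w y = (T p y).+1].
  apply: (simplicial_leaf HT wU (AU cA)).
    by rewrite ltnNge KT.
  by move=> y t; rewrite !inE => yw tw; rewrite !KT //; exact: simp_w.
have pw : p != w by apply/eqP => E; move: wp; rewrite E (tmxx HT).
have pA : p \in A by rewrite inE pw; move: pU; rewrite inE.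
have uP y : y \in A -> S u y = (S c y).+1.
  by move=> yA; apply: cP; [exact: AW | case/andP: yA].
have wP y : y \in A -> T w y = (T p y).+1.
  by move=> yA; apply: pP; [exact: AU | case/andP: yA].
have HX : tmetric A S.
  apply: (sub_tmetric HS) => [y|y t r yA tA rW]; first exact: AW.
  move=> E; rewrite inE; apply/andP; split; first by move: rW; rewrite inE.
  apply/eqP => F; move: E; rewrite F; have := AW yA; have := AW tA => tW yW.
  by rewrite (tmC HS) // !uP //; tri HS y t c; tlia.
have HY : tmetric A T.
  apply: (sub_tmetric HT) => [y|y t r yA tA rU]; first exact: AU.
  move=> E; rewrite inE; apply/andP; split; last by move: rU; rewrite inE.
  apply/eqP => F; move: E; rewrite F; have := AU yA; have := AU tA => tU yU.
  by rewrite (tmC HT) // !wP //; tri HT y t p; tlia.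
have KX y t : y \in A -> t \in A -> (S y t <= 3) = k y t.
  by move=> /AW yA /AW tA; apply: KS; [move: yA | move: tA]; rewrite inE.
have KY y t : y \in A -> t \in A -> (T y t <= 3) = k y t.
  by move=> /AU yA /AU tA; apply: KT; [move: yA | move: tA]; rewrite inE.
have KST y t : y \in A -> t \in A -> (T y t <= 3) = (S y t <= 3).
  by move=> yA tA; rewrite KX ?KY.
have kw y : y \in A -> k w y = (T p y <= 2).
  by move=> yA; rewrite -KT ?wP //; have := AU yA; rewrite inE.
have ku y : y \in A -> k u y = (S c y <= 2).
  by move=> yA; rewrite -KS ?uP //; have := AW yA; rewrite inE.
have pc : 3 <= T p c by move: ncw; rewrite kw //; tlia.
have extend_S q : q \in A -> (forall y, y \in A -> k w y = (S q y <= 2)) ->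
    exists e, tmetric predT e /\ forall y t, (e y t <= 3) = k y t.
  move=> qA kq; apply: (extend HS qA _ KS kq).
  have kwq : k w q by rewrite kq // (tmxx HX).
  have := far_u _ kwq; rewrite uP // => /(_ (AW qA)) h1.
  by have := kq c cA; rewrite (negPf ncw) => h2; rewrite (tmC HS) ?uP //; [sym2 HX q c; tlia | exact: AW].
geo HY p c 1 g; rename zA into gA, dz into pg.
(* A second leaf [l] at [p] is a twin of [w], so [w] is attached in [S] where [l] is. *)
have [/existsP[l /and3P[lA /eqP pl lg]]|/existsPn no_l] :=
  boolP [exists l, [&& l \in A, T p l == 1 & l != g]].
  have lpos : 0 < T l g by rewrite lt0n (tm0 HY).
  have lE y : y \in A -> (T l y <= 3) = (T p y <= 2).
    move=> yA; apply/idP/idP => h; last by tri HY p l y; tlia.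
    rewrite leqNgt; apply/negP => h2; geo HY p y 2 y2; geo HY p c 2 g2.
    have h3 : T l y = T p y - 1 by tri HY p l y; tlia.
    have h4 : T l y2 = 1 by quad HY p y l y2; tlia.
    have h5 : T g g2 = 1 by quad HY p c g g2; tlia.
    have h6 : T y2 g2 = 4 by quad HY p l g y2; quad HY p g y2 g2; tlia.
    have := @simp_w y2 g2; rewrite !kw // -KY // h6 dz dz2; tlia.
  have [q [qA lq qP]] : exists q, [/\ q \in A, S l q = 1 &
      forall y, y \in A -> y != l -> S l y = (S q y).+1].
    apply: (simplicial_leaf HX lA cA); first by have := lE c cA; have := KST l c lA cA; tlia.
    by move=> y t yA tA; rewrite -!KST // !lE // KY // -!kw //; exact: simp_w.
  apply: (extend_S q qA) => y yA; rewrite kw //.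
  have [->|yl] := eqVneq y l; first by rewrite pl (tmC HX) // lq.
  by rewrite -lE // KST // qP.
have gP y : y \in A -> y != p -> T p y = (T g y).+1.
  move=> yA yp; have : 0 < T p y by rewrite lt0n (tm0 HY) // eq_sym.
  move=> h; geo HY p y 1 n; have := no_l n; rewrite zA dz eqxx /= negbK => /eqP E.
  by rewrite -E; tlia.
have kwg y : y \in A -> k w y = (T g y <= 1).
  move=> yA; rewrite kw //; have [->|yp] := eqVneq y p; last by rewrite gP.
  by rewrite (tmxx HY) // (tmC HY) // pg.
(* The cube sees the star of [g] as the common neighbours of [y1] and [y2], so it is
   the star of a vertex [m] in [S]; counting shows that [m] has a leaf [q], which
   takes the role of [p]. *)
have [|/existsPn clq] := boolP [exists y1, exists y2,
  [&& y1 \in A, y2 \in A, T g y1 <= 2, T g y2 <= 2 & 4 <= T y1 y2]].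
  case/existsP => y1 /existsP[y2 /and5P[y1A y2A gy1 gy2 y12]].
  have [g1 g2] : T g y1 = 2 /\ T g y2 = 2 by tri HY g y1 y2; tlia.
  have T12 : T y1 y2 = 4 by tri HY g y1 y2; tlia.
  geo HY g y1 1 n1.
  have S12 : 4 <= S y1 y2 by have := KST y1 y2 y1A y2A; tlia.
  have comm q : q \in A -> (S y1 q <= 3) && (S y2 q <= 3) = (T g q <= 1).
    by move=> qA; rewrite -!KST //; apply/idP/idP => h;
      [quad HY y1 y2 g q | tri HY g y1 q; tri HY g y2 q]; tlia.
  have gp : T g p = 1 by sym2 HY g p; tlia.
  have y1p : y1 != p by apply/eqP => E; move: g1; rewrite E; tlia.
  have pn1 : p != n1 by apply/eqP => E; have := gP y1 y1A y1p; rewrite {1}E; tlia.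
  have [cp1 cp2] : S y1 p <= 3 /\ S y2 p <= 3 by apply/andP; rewrite comm // gp.
  have [cg1 cg2] : S y1 g <= 3 /\ S y2 g <= 3 by apply/andP; rewrite comm // (tmxx HY).
  have [cn1 cn2] : S y1 n1 <= 3 /\ S y2 n1 <= 3 by apply/andP; rewrite comm // dz.
  have pos q r : q \in A -> r \in A -> q != r -> 0 < S q r by move=> qA rA; rewrite lt0n (tm0 HX).
  (* Two vertices at distance 5 have only two common cube-neighbours, at distance 6 only one; the
     distinct [p], [g], [n1] force distance 4. *)
  have Sy12 : S y1 y2 = 4.
    have h1 := pos p n1 pA zA pn1.
    have h2 : 0 < S p g by apply: pos => //; apply/eqP => E; move: gp; rewrite E (tmxx HY).
    have h3 : 0 < S g n1 by apply: pos => //; apply/eqP => E; move: dz; rewrite -E (tmxx HY).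
    by quad HX y1 y2 p g; quad HX y1 y2 p n1; quad HX y1 y2 g n1; tlia.
  geo HX y1 y2 2 m; rename zA into n1A, zA0 into mA, dz into gn1, dz1 into y1m, dz2 into my2.
  have mE q : q \in A -> (S m q <= 1) = (T g q <= 1).
    move=> qA; rewrite -comm //.
    by apply/idP/idP => h; [tri HX y1 m q; tri HX y2 m q | quad HX y1 y2 m q]; tlia.
  have [/existsP[q /and3P[qA /eqP mq /forallP ql]]|no_leaf] :=
    boolP [exists q, [&& q \in A, S m q == 1 & [forall t, (t \in A) && (S q t == 1) ==> (t == m)]]].
    apply: (extend_S q qA) => y yA; rewrite kwg // -mE //.
    have [->|yq] := eqVneq y q; first by rewrite mq (tmxx HX).
    have h := pos y q yA qA yq; rewrite (tmC HX) // in h.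
    geo HX q y 1 r; have := ql r; rewrite zA dz eqxx /= => /eqP E.
    by rewrite E in dz1; tlia.
  pose NT := [set q | (q \in A) && (T g q == 1)]; pose NS := [set q | (q \in A) && (S m q == 1)].
  have cNT : #|[set q | (q \in A) && (T g q <= 1)]| = #|NT|.+1.
    rewrite (cardsD1 g) in_set gA (tmxx HY) //=; congr _.+1; apply: eq_card => q; rewrite in_setD1 !in_set.
    by case: (boolP (q \in A)) => qA; rewrite ?andbF //= ?andbT eq_sym -(tm0 HY) //; case: (T g q) => [|[]].
  have cNS : #|[set q | (q \in A) && (S m q <= 1)]| = #|NS|.+1.
    rewrite (cardsD1 m) in_set mA (tmxx HX) //=; congr _.+1; apply: eq_card => q; rewrite in_setD1 !in_set.
    by case: (boolP (q \in A)) => qA; rewrite ?andbF //= ?andbT eq_sym -(tm0 HX) //; case: (S m q) => [|[]].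
  have eqN : #|NS| = #|NT|.
    apply: succn_inj; rewrite -cNS -cNT; apply: eq_card => q; rewrite !in_set.
    by case: (boolP (q \in A)) => //= qA; rewrite mE.
  (* Without a leaf at [m], each neighbour [q] has a further neighbour [t], which [T] puts at
     distance 2 from [g]; [f] sends [q] to the neighbour of [g] before [t]. Equal images would make
     two such [t] adjacent in the cube although [S] has them 4 apart, and the leaf [p] of [T] is
     never an image: [f] injects [NS] into a smaller set. *)
  pose R q n := [&& n \in A, T g n == 1 & [exists t, [&& t \in A, S q t == 1, t != m & T n t == 1]]].
  pose f q := odflt g [pick n | R q n].
  have fP q : q \in NS -> R q (f q).
    rewrite in_set => /andP[qA /eqP mq]; rewrite /f; case: pickP => //= noR; exfalso.
    have := no_leaf; rewrite negb_exists => /forallP/(_ q); rewrite qA mq eqxx /= negb_forall.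
    case/existsP => t; rewrite negb_imply -andbA => /and3P[tA /eqP qt tm].
    have mt : S m t = 2 by have := pos t m tA mA tm; tri HX m q t; tlia.
    have gt : 2 <= T g t by have := mE t tA; tlia.
    have k1 := KST t p tA pA; have k2 := KST t n1 tA n1A.
    have m1 := mE p pA; have m2 := mE n1 n1A.
    have tp : T t p <= 3 by tri HX m t p; tlia.
    have tn : T t n1 <= 3 by tri HX m t n1; tlia.
    have p1 : 0 < T p n1 by rewrite lt0n (tm0 HY).
    have gt2 : T g t = 2 by quad HY g p n1 t; tlia.
    geo HY g t 1 n; have /negP[] := noR n; rewrite /R zA dz eqxx /=; apply/existsP; exists t.
    by rewrite tA qt tm dz1 gt2 !eqxx.
  have RP q n : q \in NS -> R q n ->
      exists t, [/\ t \in A, S q t = 1, S m t = 2, T n t = 1 & [/\ n \in A, T g n = 1 & T g t = 2]].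
    rewrite in_set => /andP[qA /eqP mq] /and3P[nA /eqP gn /existsP[t /and4P[tA /eqP qt tm /eqP nt]]].
    have mt : S m t = 2 by have := pos t m tA mA tm; tri HX m q t; tlia.
    exists t; split=> //; split=> //.
    by have := mE t tA; tri HY g n t; tlia.
  have finj : {in NS &, injective f}.
    move=> q1 q2 h1 h2 E; have [t1 [t1A q1t1 mt1 nt1 _]] := RP q1 _ h1 (fP q1 h1).
    have [t2 [t2A q2t2 mt2 nt2 [nA _ _]]] := RP q2 _ h2 (fP q2 h2).
    move: h1 h2; rewrite !in_set => /andP[q1A /eqP mq1] /andP[q2A /eqP mq2]; rewrite E in nt1.
    apply/eqP/negPn/negP => ne; have h3 := pos q1 q2 q1A q2A ne.
    have h4 : T t1 t2 <= 2 by tri HY (f q2) t1 t2; tlia.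
    have := KST t1 t2 t1A t2A.
    have h5 : S q1 t2 = 3 by quad HX m q1 q2 t2; tlia.
    by quad HX m q1 t1 t2; tlia.
  have : #|f @: NS| <= #|NT :\ p|.
    apply/subset_leq_card/subsetP => _ /imsetP[q qN ->].
    have [t [tA qt mt nt [nA gn gt]]] := RP q _ qN (fP q qN); rewrite in_setD1 in_set nA gn eqxx !andbT.
    apply/eqP => E; rewrite E in nt; have tp : t != p by apply/eqP => F; rewrite F in gt; tlia.
    by have := gP t tA tp; tlia.
  by rewrite card_in_imset // eqN (cardsD1 p NT) in_set pA gp eqxx add1n ltnn.
(* Otherwise the ball of radius 2 about [g] is a clique, so [g] has a single neighbour
   [h] leading further, and likewise for the neighbour [gs] of [p] in [S]. Either
   [gs] can be exchanged with [g], or [p] is too close to [u]. *)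
have clqY y t : y \in A -> t \in A -> T g y <= 2 -> T g t <= 2 -> T y t <= 3.
  move=> yA tA h1 h2; rewrite leqNgt; apply/negP => h3.
  by have := clq y => /existsPn/(_ t); rewrite yA tA h1 h2 h3.
have [z [zzA gz]] : exists z, z \in A /\ 3 <= T g z.
  have Scb : 5 <= S c b by have := uP b bA; tlia.
  have [h|h] := leqP 3 (T g c); first by exists c.
  have [h'|h'] := leqP 3 (T g b); first by exists b.
  by have := clqY c b cA bA ltac:(tlia) ltac:(tlia); have := KST c b cA bA; tlia.
geo HY g z 1 h; rename zA into hA, dz into gh, dz1 into hz.
have pz : p != z by apply/eqP => E; move: gz; rewrite -E (tmC HY) // pg; tlia.
have pz4 : 4 <= T p z by rewrite gP // eq_sym.
have [gs [gsA pgs gsP]] : exists gs, [/\ gs \in A, S p gs = 1 &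
    forall y, y \in A -> y != p -> S p y = (S gs y).+1].
  apply: (simplicial_leaf HX pA zzA); first by have := KST p z pA zzA; tlia.
  move=> y t yA tA; rewrite -!KST // => h1 h2; apply: clqY => //.
    by have [->|/(gP y yA)] := eqVneq y p; [sym2 HY g p|]; tlia.
  by have [->|/(gP t tA)] := eqVneq t p; [sym2 HY g p|]; tlia.
have DE y : y \in A -> (T g y <= 2) = (S gs y <= 2).
  move=> yA; have [->|yp] := eqVneq y p; first by sym2 HY g p; sym2 HX gs p; tlia.
  by have := KST p y pA yA; rewrite gP // gsP.
have clqX y t : y \in A -> t \in A -> S gs y <= 2 -> S gs t <= 2 -> S y t <= 3.
  by move=> yA tA; rewrite -!DE // -KST //; exact: clqY.
have gsz : 3 <= S gs z by have := DE z zzA; tlia.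
geo HX gs z 1 hs; rename zA into hsA, dz into gshs, dz1 into hsz.
have dirY y (yA : y \in A) := leaf_direction HY gA zzA hA yA gz clqY gh hz.
have dirX y (yA : y \in A) := leaf_direction HX gsA zzA hsA yA gsz clqX gshs hsz.
have BE y : y \in A -> (T h y <= 1) = (S hs y <= 1).
  move=> yA; apply/(second_ball HY gA zzA hA yA gz clqY gh hz)/
    (second_ball HX gsA zzA hsA yA gsz clqX gshs hsz).
    case=> h1 [t [tA h2 h3]]; split; first by rewrite -DE.
    by exists t; split; rewrite -?KST //; have := DE t tA; tlia.
  case=> h1 [t [tA h2 h3]]; split; first by rewrite DE.
  by exists t; split; rewrite ?KST //; have := DE t tA; tlia.
have kwgs : k w p by rewrite kwg // (tmC HY) // pg.
have cp : c != p by apply/eqP => E; move: ncw; rewrite E kwgs.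
have near_p t : t \in A -> S p t <= 3 -> S gs t <= 2.
  by move=> tA; have [->|tp] := eqVneq t p; [sym2 HX gs p; tlia | rewrite gsP].
(* Otherwise [c] is in the star of [gs]. If it is [gs], [p] contradicts [far_simp]; if it is [hs],
   [p] is farther from [b] than [u] is; any other neighbour of [gs] is outside the star of [hs],
   hence in that of [g], and so adjacent to [w]. *)
have kpu : ~~ k p u.
  apply/negP => kpu.
  have h1 : S u p <= 3 by rewrite KS ?(ksym u) //; have := AW pA; rewrite inE.
  have h2 : S gs c <= 1.
    by move: h1; rewrite uP // (tmC HX) // gsP.
  have [E|ne] := eqVneq c gs.
    have : 6 <= S u p.
      apply: far_simp => //.
      have kpt t : t != w -> t != u -> k p t -> k u t.
        move=> tw tu; have tA : t \in A by rewrite inE tw.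
        rewrite ku // -KX // E; have [->|tp] := eqVneq t p; last by rewrite gsP.
        by sym2 HX gs p; tlia.
      move=> y t yw tw; have [->|yu] := eqVneq y u; have [->|tu] := eqVneq t u => //.
      - by move=> _; exact: kpt.
      - by move=> /(kpt y yw yu); rewrite ksym.
      have yA : y \in A by rewrite inE yw. have tA : t \in A by rewrite inE tw.
      rewrite -!KX // => h3 h4; apply: clqX => //; exact: near_p.
    by tlia.
  have gsc : 0 < S gs c by rewrite lt0n (tm0 HX) // eq_sym.
  have [E|nh] := eqVneq c hs.
    have h3 : S gs b >= 2 by have := uP b bA; rewrite E; tri HX gs hs b; tlia.
    have h4 := dirX b bA h3.
    have bp : b != p by apply/eqP => F; move: Sb; rewrite F; tlia.
    have := gsP b bA bp; have := uP b bA; rewrite E; have := Smax (y := p) (t := b); rewrite bw.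
    have := AW pA; rewrite inE => -> /(_ isT isT); tlia.
  have : ~~ (T g c <= 1) by rewrite -kwg.
  have h3 := DE c cA; have h4 := dirY c cA; have h5 := BE c cA.
  have : 0 < S hs c by rewrite lt0n (tm0 HX) // eq_sym.
  move=> h6 h7; have h8 := h4 ltac:(tlia).
  by tri HX gs hs c; tlia.
have Sup : 6 <= S u p.
  apply: far_simp => //.
  move=> y t yw tw; have [->|yu] := eqVneq y u; first by rewrite (negPf kpu).
  have [->|tu] := eqVneq t u; first by rewrite (negPf kpu).
  have yA : y \in A by rewrite inE yw. have tA : t \in A by rewrite inE tw.
  rewrite -!KX // => h3 h4; apply: clqX => //; exact: near_p.
have gsc : 4 <= S gs c by move: Sup; rewrite uP // (tmC HX) // gsP.
have hsc : S hs c = S gs c - 1 by apply: dirX => //; tlia.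
have KST2 : {in A &, forall y t, (T y t <= 3) = (S y t <= 3)} by move=> y t; exact: KST.
have KST3 : {in A &, forall y t, (S y t <= 3) = (T y t <= 3)} by move=> y t yA tA; rewrite KST.
have BE2 : {in A, forall y, (T h y <= 1) = (S hs y <= 1)} by move=> y; exact: BE.
have BE3 : {in A, forall y, (S hs y <= 1) = (T h y <= 1)} by move=> y yA; rewrite BE.
have hg : T h g = 1 by rewrite (tmC HY).
have hsgs : S hs gs = 1 by rewrite (tmC HX).
have kwh : k w h by rewrite kwg // gh.
(* If the two stars had different centres, the depth bounds in both metrics would put every vertex
   within cube reach of [h], against [nodom]. *)
have hhs : h = hs.
  apply/eqP/negPn/negP => ne; have ne' : hs != h by rewrite eq_sym.
  have hsc4 : S hs c <= 3.
    by apply: (shifted_centre_depth HX HY KST3 hsA hA gsA cA ne' BE3 hsgs); tlia.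
  have [y0 ny] := nodom h.
  have y0w : y0 != w by apply: contraNneq ny => ->; rewrite ksym.
  have [E|y0u] := eqVneq y0 u.
    have [h1 h2] := shifted_centre HX HY KST3 hsA hA gsA cA ne' BE3 hsgs ltac:(tlia) ltac:(tlia).
    have : S u h <= 3 by rewrite uP // (tmC HX) //; tlia.
    by rewrite KS ?(ksym u) -?E ?(negPf ny) //; have := AW hA; rewrite inE.
  have y0A : y0 \in A by rewrite inE y0w.
  have h1 : 4 <= T h y0 by rewrite ltnNge KY // ny.
  have h2 := dirY y0 y0A.
  have h3 : T h y0 <= 3.
    apply: (shifted_centre_depth HY HX KST2 hA hsA gA y0A ne BE2 hg).
    by have := h2 ltac:(tri HY g h y0; tlia); tri HY g h y0; tlia.
  by tlia.
subst hs.
have twin y : y \in A -> k g y = k gs y.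
  move=> yA; rewrite -KY // -KX //.
  have d1 := dirY y yA; have d2 := dirX y yA; have k1 := KST g y gA yA; have k2 := KST gs y gsA yA.
  have b1 := BE g gA; have b2 := BE gs gsA.
  apply/idP/idP => h1.
    have h2 : T h y <= 2 by have [h3|h3] := leqP 2 (T g y); [have := d1 h3 | tri HY g h y]; tlia.
    by tri HY h gs y; tlia.
  have h2 : S h y <= 2 by have [h3|h3] := leqP 2 (S gs y); [have := d2 h3 | tri HX gs h y]; tlia.
  by tri HX h g y; tlia.
have gW := AW gA; have gsW := AW gsA.
have kgsu : k gs u = false.
  have := KS (y := u) (t := gs) uW gsW; rewrite uP // (tmC HX) // ksym => <-; tlia.
have kgu : k g u = false.
  apply/negP => kgu; have := KS (y := u) (t := g) uW gW; rewrite uP // (ksym u) kgu => h1.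
  have h2 : S h g <= 1 by rewrite -BE // hg.
  have k1 := twin c cA; rewrite -KX // -KX // in k1; sym2 HX gs c; tri HX h g c; tlia.
have twinW y : y != w -> k g y = k gs y.
  by move=> yw; have [->|yu] := eqVneq y u; [rewrite kgu kgsu | rewrite twin // inE yw].
(* [g] and [gs] are now twins off [w]: the swap keeps the cube there and carries the star of [g] in
   [T] to the star of [gs] in [S], which is the 2-ball of [p]. *)
pose s := tperm g gs.
have sE y : y != w -> forall t, t != w -> k (s y) t = k y t.
  by move=> yw t tw; rewrite /s; case: tpermP => [->|->|//]; rewrite twinW.
have sw y : (s y == w) = (y == w).
  rewrite /s; case: tpermP => [->|->|//]; move: gW gsW; rewrite !inE => /negPf-> /negPf-> //.
have sp : s p = p.
  rewrite /s tpermD //; first by apply/eqP => E; move: pg; rewrite -E (tmxx HY).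
  by apply/eqP => E; move: pgs; rewrite -E (tmxx HX).
have su : s u = u by rewrite /s tpermD //; [move: gA | move: gsA]; rewrite inE => /andP[].
have HS' : tmetric (predC1 w) (fun y t => S (s y) (s t)).
  by apply: (perm_tmetric (tpermK g gs) (tpermK g gs) _ HS) => y; rewrite !inE; congr negb; exact: sw.
apply: (extend HS' pA).
- by rewrite sp su (tmC HS) //; tlia.
- by move=> y t yw tw; rewrite KS ?sw // sE ?sw // ksym sE // ksym.
move=> y yA; rewrite sp kwg //.
have pgE t : t \in A -> (S p t <= 2) = (S gs t <= 1).
  by move=> tA; have [->|tp] := eqVneq t p; [rewrite (tmxx HX) // (tmC HX) // pgs | rewrite gsP].
have [E|yg] := eqVneq y g; first by rewrite E /s tpermL pgE // !(tmxx HX, tmxx HY).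
have [E|ygs] := eqVneq y gs.
  rewrite E /s tpermR pgE //; have b1 := BE g gA; have b2 := BE gs gsA.
  have ne : g != gs by rewrite -E eq_sym.
  have h1 : 0 < S gs g by rewrite lt0n (tm0 HX) // eq_sym.
  have h2 : 0 < T g gs by rewrite lt0n (tm0 HY).
  have hgs : 0 < T h gs by rewrite lt0n (tm0 HY) // -(tm0 HX) // -lt0n hsgs.
  have hg' : 0 < S h g by rewrite lt0n (tm0 HX) // -(tm0 HY) // -lt0n hg.
  by tri HX h gs g; tri HY h gs g; tlia.
rewrite /s tpermD 1?eq_sym // pgE //.
have h1 := DE y yA; have h2 := dirY y yA; have h3 := dirX y yA; have h4 := BE y yA.
have [->|yh] := eqVneq y h; first by rewrite gh gshs.
have h5 : 0 < T g y by rewrite lt0n (tm0 HY) // eq_sym.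
have h6 : 0 < S gs y by rewrite lt0n (tm0 HX) // eq_sym.
have h7 : 0 < T h y by rewrite lt0n (tm0 HY) // eq_sym.
have h8 : 0 < S h y by rewrite lt0n (tm0 HX) // eq_sym.
have [h9|h9] := leqP 2 (T g y); have [h10|h10] := leqP 2 (S gs y).
- by tlia.
- by have := h2 h9; tri HX gs h y; tlia.
- by have := h3 h10; tri HY g h y; tlia.
- by tlia.
Qed.
End Recognition.

(** * Choosing the two deleted vertices *)

Section FarSimplicial.
Variables (V : finType) (A : {pred V}) (d : V -> V -> nat).
Hypothesis H : tmetric A d.

Let simp p := forall y t, y \in A -> t \in A -> d p y <= 3 -> d p t <= 3 -> d y t <= 3.

(** On the way from [p0] to [u], [p1] is within 3 of [y3] since [p0] is simplicial, but not of [y4]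
    since [p1] is. So [p1] reaches [u] through [y3], in as many steps as [p0]. *)
Lemma simplicial_twin_far p0 p1 u : p0 \in A -> p1 \in A -> u \in A -> simp p0 -> simp p1 ->
  d p0 p1 <= 3 -> 6 <= d u p0 -> 6 <= d u p1.
Proof.
move=> p0A p1A uA s0 s1 d01 du; sym2 H u p0.
geo H p0 u 3 y3; geo H p0 u 4 y4.
have h1 := s0 p1 y3 p1A zA d01 ltac:(tlia).
have h2 : 4 <= d p1 y4.
  rewrite ltnNge; apply/negP => h; sym2 H p0 p1.
  by have := s1 p0 y4 p0A zA0 ltac:(tlia) h; tlia.
have h3 : d y3 y4 = 1 by quad H p0 u y3 y4; tlia.
have h4 : d p1 y3 = 3 by tri H p1 y3 y4; tlia.
by sym2 H u p1; quad H p1 y4 y3 u; tlia.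
Qed.

(** Were [p0] within 5 of both ends, the vertices 3 steps towards them would be at most 3 apart, so
    [d a b <= 2 + 3 + 2]; equality is excluded by parity, [5 + 5 + 7] being odd. *)
Lemma simplicial_far_end p0 a b : p0 \in A -> a \in A -> b \in A -> simp p0 -> 7 <= d a b ->
  6 <= d a p0 \/ 6 <= d b p0.
Proof.
move=> p0A aA bA s0 dab; case: (leqP 6 (d a p0)) => ha; [by left|].
case: (leqP 6 (d b p0)) => hb; [by right|exfalso].
sym2 H a p0; sym2 H b p0.
geo H p0 a (minn 3 (d p0 a)) ya; geo H p0 b (minn 3 (d p0 b)) yb.
have h := s0 ya yb zA zA0 ltac:(tlia) ltac:(tlia).
have : d a b <= d a ya + d ya yb + d yb b.
  by tri H a ya b; tri H ya yb b; tlia.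
by tri H p0 a b; sym2 H a ya; quad H p0 a b ya; quad H p0 ya b yb; tlia.
Qed.

Lemma end_simplicial a b : a \in A -> b \in A -> (forall y t, y \in A -> t \in A -> d y t <= d a b) -> simp a.
Proof.
move=> aA bA dmax y t yA tA hy ht; have := dmax y b yA bA; have := dmax t b tA bA.
by quad H a b y t; tlia.
Qed.

End FarSimplicial.

Lemma tmetric_ends (V : finType) (A : {pred V}) (d : V -> V -> nat) (y t : V) :
    y \in A -> t \in A ->
  exists a b, [/\ a \in A, b \in A & forall y t, y \in A -> t \in A -> d y t <= d a b].
Proof.
move=> yA tA; have yt : [pred q : V * V | (q.1 \in A) && (q.2 \in A)] (y, t) by rewrite /= yA tA.
case: (arg_maxnP (fun q : V * V => d q.1 q.2) yt) => -[a b] /= /andP[aA bA] mx.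
by exists a, b; split=> // p q pA qA; apply: (mx (p, q)); rewrite /= pA qA.
Qed.

Section ChooseFar.
Variables (V : finType) (k : rel V) (w : V) (S : V -> V -> nat).
(** The second alternative arises when the ends of a diametral path of the cube are its only
    simplicial vertices: deleting one may shorten the diameter to 6, but leaves only one other
    simplicial vertex. *)
Definition spread :=
  (exists y t, [/\ y != w, t != w & 7 <= S y t]) \/
  (exists y t, [/\ y != w, t != w & 6 <= S y t]) /\
  (forall y t, y != w -> t != w -> y != t -> (forall p q, k y p -> k y q -> k p q) ->
    (forall p q, k t p -> k t q -> k p q) -> False).

Definition far_end u b := [/\ u != w /\ b != w, ~~ k w u,
  6 <= S u b /\ (forall y t, y != w -> t != w -> S y t <= S u b),
  forall q, q != w -> k w q -> 2 <= S u q &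
  forall q, q != w -> k w q ->
    (forall y t, y != w -> t != w -> k q y -> k q t -> k y t) -> 6 <= S u q].

Hypotheses (ksym : symmetric k).
Hypotheses (HS : tmetric (predC1 w) S).
Hypothesis KS : forall y t, y != w -> t != w -> (S y t <= 3) = k y t.
Hypothesis simp_w : forall y t, k w y -> k w t -> k y t.
Hypothesis large : spread.

(** [u] is an end of a diametral path of [S], chosen according to [w]: opposite to an end adjacent
    to [w]; failing that, far from a simplicial neighbour of [w]; failing that, [b] if [w] has a
    neighbour within 1 of [a], and [a] otherwise. *)
Lemma choose_far_end : exists u b, far_end u b.
Proof.
have [y0 [t0 [yw tw S6]]] : exists y t, [/\ y != w, t != w & 6 <= S y t].
  by case: large => [[y [t [? ? ?]]]|[]//]; exists y, t; split=> //; tlia.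
have yA : y0 \in predC1 w by rewrite inE. have tA : t0 \in predC1 w by rewrite inE.
have [a [b [aA bA mx]]] := tmetric_ends S yA tA.
have {}S6 : 6 <= S a b by have := mx _ _ yA tA; tlia.
have simpE q : q != w -> (forall y t, y != w -> t != w -> k q y -> k q t -> k y t) ->
    forall y t, y \in predC1 w -> t \in predC1 w -> S q y <= 3 -> S q t <= 3 -> S y t <= 3.
  by move=> qw h y t; rewrite !inE => y1 t1; rewrite !KS //; exact: h.
have pack u c : u \in predC1 w -> c \in predC1 w -> S u c = S a b ->
    (forall q, q != w -> k w q -> 3 <= S u q) \/ ((forall q, q != w -> k w q -> 2 <= S u q) /\ ~~ k w u /\
      forall q, q != w -> k w q -> (forall y t, y != w -> t != w -> k q y -> k q t -> k y t) -> False) ->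
    (forall q, q != w -> k w q -> (forall y t, y != w -> t != w -> k q y -> k q t -> k y t) ->
      exists p, [/\ p != w, k w p, (forall y t, y != w -> t != w -> k p y -> k p t -> k y t) & 6 <= S u p]) ->
    exists u b, far_end u b.
  move=> uA cA Sc near far; have uw : u != w by rewrite inE in uA.
  exists u, c; split.
  - by split=> //; rewrite inE in cA.
  - case: near => [h|[_ []//]]; apply/negP => /(h u uw); rewrite (tmxx HS) //.
  - by rewrite Sc; split=> // y t y1 t1; apply: mx; rewrite inE.
  - move=> q qw kq; case: near => [h|[h _]]; last exact: h.
    by have := h q qw kq; tlia.
  - move=> q qw kq sq; have [p [pw kp sp Sp]] := far q qw kq sq.
    have qA : q \in predC1 w by rewrite inE. have pA : p \in predC1 w by rewrite inE.
    apply: (simplicial_twin_far HS pA qA uA (simpE p pw sp) (simpE q qw sq) _ Sp).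
    by rewrite KS //; exact: simp_w.
have aw : a != w by rewrite inE in aA. have bw : b != w by rewrite inE in bA.
have Sba : S b a = S a b by rewrite (tmC HS).
have endP u c : u != w -> c != w -> S u c = S a b ->
    forall y t, y != w -> t != w -> k u y -> k u t -> k y t.
  move=> uw cw E y t y1 t1; rewrite -!KS //; apply: (end_simplicial HS (b := c)); rewrite ?inE //.
  by move=> p q pA qA; rewrite E; exact: mx.
have one u c : u != w -> c != w -> S u c = S a b -> k w c ->
    exists u b, far_end u b.
  move=> uw cw E kc; have uA : u \in predC1 w by rewrite inE. have cA : c \in predC1 w by rewrite inE.
  apply: (pack u c) => //.
    left=> q qw kq; have qA : q \in predC1 w by rewrite inE.
    by have := KS qw cw; rewrite simp_w // => h; tri HS u q c; tlia.
  move=> _ _ _ _; exists c; split=> //; last by rewrite E.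
  by apply: (endP c u) => //; rewrite (tmC HS).
have [kb|kb] := boolP (k w b); first exact: (one a b).
have [ka|ka] := boolP (k w a); first exact: (one b a).
have ab : a != b by apply/eqP => E; move: S6; rewrite E (tmxx HS).
(* Not being adjacent to [w], both ends are simplicial in the whole graph, which the second
   alternative of [spread] forbids. *)
have S7 : 7 <= S a b.
  case: large => [[y [t [h1 h2 h3]]]|[_ h]].
    by apply: leq_trans h3 _; apply: mx; rewrite inE.
  have whole u c : u != w -> c != w -> S u c = S a b -> ~~ k w u -> forall p q, k u p -> k u q -> k p q.
    move=> uw cw E ku p q kp kq; apply: (endP u c) => //.
    - by apply: contraNneq ku => <-; rewrite ksym.
    - by apply: contraNneq ku => <-; rewrite ksym.
  by case: (h a b aw bw ab); [exact: (whole a b) | exact: (whole b a)].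
have [/existsP[p0 /and3P[p0w kp0 sp0]]|no_p] :=
  boolP [exists p0, [&& p0 != w, k w p0 & [forall y, forall t,
    [&& y != w, t != w, k p0 y & k p0 t] ==> k y t]]].
  have sp y t : y != w -> t != w -> k p0 y -> k p0 t -> k y t.
    by move=> h1 h2 h3 h4; have := forallP (forallP sp0 y) t; rewrite h1 h2 h3 h4.
  have p0A : p0 \in predC1 w by rewrite inE.
  have fin u c : u \in predC1 w -> c \in predC1 w -> S u c = S a b -> 6 <= S u p0 ->
      exists u b, far_end u b.
    move=> uA cA E Sp; apply: (pack u c) => //; last by move=> *; exists p0.
    left=> q qw kq; have qA : q \in predC1 w by rewrite inE.
    by have := KS qw p0w; rewrite simp_w // => h; tri HS u q p0; tlia.
  have [h|h] := simplicial_far_end HS p0A aA bA (simpE p0 p0w sp) S7; first exact: (fin a b).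
  exact: (fin b a).
have none q : q != w -> k w q -> (forall y t, y != w -> t != w -> k q y -> k q t -> k y t) -> False.
  move=> qw kq sq; case/negP: no_p; apply/existsP; exists q; rewrite qw kq /=.
  by apply/forallP => y; apply/forallP => t; apply/implyP => /and4P[? ? ? ?]; exact: sq.
have [/existsP[q0 /and3P[q0w kq0 Sq0]]|noq] := boolP [exists q, [&& q != w, k w q & S a q <= 1]].
  apply: (pack b a) => //; last by move=> q qw kq sq; case: (none q qw kq sq).
  right; split; [|by split].
  move=> q qw kq; have qA : q \in predC1 w by rewrite inE. have q0A : q0 \in predC1 w by rewrite inE.
  have h : S q0 q <= 3 by rewrite KS // simp_w.
  by tri HS a q0 q; tri HS a q b; tlia.
apply: (pack a b) => //; last by move=> q qw kq sq; case: (none q qw kq sq).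
right; split; [|by split].
move=> q qw kq; rewrite leqNgt; apply/negP => h; case/negP: noq.
by apply/existsP; exists q; rewrite qw kq.
Qed.
End ChooseFar.

(** * Metrics whose cubes agree off one vertex *)

(* [v - a1 - x - b1 - b2 - b3 - b4] starts a diametral path of [d] towards [z], and
   [e] is a second tree metric with the same cube away from [x]. *)
Section Gap.
Variables (V : finType) (d e : V -> V -> nat) (x v z : V).
Hypotheses (Hd : tmetric predT d) (He : tmetric predT e).
Hypothesis K : forall y t, y != x -> t != x -> (d y t <= 3) = (e y t <= 3).
Hypotheses (D7 : 7 <= d v z) (vx : d v x = 2) (xz : d x z = d v z - 2).
Hypothesis dmax : forall y t, d y t <= d v z.
Variables (a1 b1 b2 b3 b4 : V).
Hypotheses (va1 : d v a1 = 1) (a1x : d a1 x = 1).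
Hypotheses (xb1 : d x b1 = 1) (xb2 : d x b2 = 2) (xb3 : d x b3 = 3) (xb4 : d x b4 = 4).
Hypotheses (b1z : d b1 z = d x z - 1) (b2z : d b2 z = d x z - 2)
  (b3z : d b3 z = d x z - 3) (b4z : d b4 z = d x z - 4).

Let on_geo p q : d x p + d p z = d x z -> d x q + d q z = d x z -> d x p <= d x q ->
  d p q = d x q - d x p.
Proof. by move=> *; quad Hd x z p q; tlia. Qed.

Let v_geo p : d x p + d p z = d x z -> d v p = d x p + 2.
Proof. by move=> *; quad Hd v z x p; tlia. Qed.

Let a1_geo p : d x p + d p z = d x z -> d a1 p = d x p + 1.
Proof. by move=> /v_geo h; tri Hd v a1 p; tri Hd x a1 p; tlia. Qed.

Let nx y : 0 < d x y -> y != x.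
Proof. by apply: contraL => /eqP->; rewrite (tmxx Hd). Qed.

Let nxd y : y != x -> 0 < d x y.
Proof. by move=> h; rewrite lt0n (tm0 Hd) // eq_sym. Qed.

Let neq y t : 0 < d y t -> y != t.
Proof. by apply: contraL => /eqP->; rewrite (tmxx Hd). Qed.

Let ne0 y t : y != t -> 0 < e y t.
Proof. by move=> h; rewrite lt0n (tm0 He). Qed.

Let nd0 y t : y != t -> 0 < d y t.
Proof. by move=> h; rewrite lt0n (tm0 Hd). Qed.

Let b1b2 : d b1 b2 = 1. Proof. by rewrite on_geo; tlia. Qed.
Let b1b3 : d b1 b3 = 2. Proof. by rewrite on_geo; tlia. Qed.
Let b1b4 : d b1 b4 = 3. Proof. by rewrite on_geo; tlia. Qed.
Let b2b3 : d b2 b3 = 1. Proof. by rewrite on_geo; tlia. Qed.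
Let b2b4 : d b2 b4 = 2. Proof. by rewrite on_geo; tlia. Qed.
Let b3b4 : d b3 b4 = 1. Proof. by rewrite on_geo; tlia. Qed.
Let a1b1 : d a1 b1 = 2. Proof. by rewrite a1_geo; tlia. Qed.
Let a1b2 : d a1 b2 = 3. Proof. by rewrite a1_geo; tlia. Qed.
Let a1b3 : d a1 b3 = 4. Proof. by rewrite a1_geo; tlia. Qed.
Let a1b4 : d a1 b4 = 5. Proof. by rewrite a1_geo; tlia. Qed.
Let vb1 : d v b1 = 3. Proof. by rewrite v_geo; tlia. Qed.
Let vb2 : d v b2 = 4. Proof. by rewrite v_geo; tlia. Qed.
Let vb3 : d v b3 = 5. Proof. by rewrite v_geo; tlia. Qed.
Let a1nx : a1 != x. Proof. by apply: neq; tlia. Qed.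
Let b1nx : b1 != x. Proof. by apply: nx; tlia. Qed.
Let b2nx : b2 != x. Proof. by apply: nx; tlia. Qed.
Let b3nx : b3 != x. Proof. by apply: nx; tlia. Qed.
Let b4nx : b4 != x. Proof. by apply: nx; tlia. Qed.
Let vnx : v != x. Proof. by apply: neq; tlia. Qed.

(* Only the direction of [z] leaves [x] farther than 2. *)
Lemma far_via y : 3 <= d x y -> d b1 y = d x y - 1.
Proof. by move=> h; have := dmax y z; quad Hd x b1 z y; tlia. Qed.

Let comm_vb2 y : y != x -> (e y v <= 3) && (e y b2 <= 3) = (d x y <= 1).
Proof. by move=> yx; rewrite -!K //; quad Hd v b2 x y; tlia. Qed.

Section Count.
Hypothesis D_eq7 : d v z = 7.
Hypothesis balls : #|[set y | (y != x) && (d x y <= 3)]| = #|[set y | (y != x) && (e x y <= 3)]|.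
Hypothesis bush : #|[set y | (y != x) && (d y z == d y x + d x z)]|
  <= #|[set y | (y != b3) && (d y v == d y b3 + d b3 v)]|.
Variable t : V.
Hypotheses (xt : d x t = 1) (tb1 : t != b1) (leaf_ext : e x t <= 3).
Hypothesis nearB : forall y, y != x -> d x y <= 3 -> d b1 y < d x y -> e x y <= 3.
Hypothesis farB : forall y, y != b3 -> d y v = d y b3 + d b3 v -> e x y <= 3.

(** In [d] the 3-ball of [x] is covered by the bush [A] behind [x] and the vertices [B] nearer to
    [b1]. In [e] it contains [B], the bush [A'] beyond [b3], and also [t]: one vertex too many. *)
Lemma ball_count_contra : False.
Proof.
have := bush; set A := [set y | _]; set A' := [set y | _] => leAA'.
set B := [set y | [&& y != x, d x y <= 3 & d b1 y < d x y]].
have le1 : #|[set y | (y != x) && (d x y <= 3)]| <= #|A| + #|B|.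
  rewrite (leq_trans _ (leq_card_setU A B)) // subset_leq_card //.
  apply/subsetP => y; rewrite !inE => /andP[yx dy]; rewrite yx dy /=.
  by quad Hd x b1 z y; tlia.
have tx : t != x by apply: nx; tlia.
have le2 : #|B| + #|A'| + 1 <= #|[set y | (y != x) && (e x y <= 3)]|.
  have A'far y : y \in A' -> 4 <= d x y.
    by rewrite inE => /andP[/nd0 yb3 /eqP yv]; quad Hd v x b3 y; tlia.
  have dj1 : [disjoint B & A'].
    by rewrite -setI_eq0; apply/eqP/setP => y; rewrite !inE; apply/negP => /andP[/and3P[? ? ?] yA];
       have := A'far y; rewrite inE yA => /(_ isT); tlia.
  have dj2 : t \notin B :|: A'.
    rewrite in_setU negb_or; apply/andP; split.
      by rewrite inE; have := nd0 tb1; sym2 Hd b1 t; tlia.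
    by apply/negP => /A'far; tlia.
  have -> : #|B| + #|A'| + 1 = #|t |: (B :|: A')|.
    by rewrite cardsU1 dj2 cardsU; move: dj1; rewrite -setI_eq0 => /eqP->; rewrite cards0 subn0 addnC.
  rewrite subset_leq_card //.
  apply/subsetP => y; rewrite in_setU1 in_setU => /or3P[/eqP->||yA]; rewrite inE.
  - by rewrite tx.
  - by rewrite inE => /and3P[yx h1 h2]; rewrite yx nearB.
  - rewrite nx ?(leq_trans _ (A'far y yA)) //=; apply: farB; move: yA; rewrite inE => /andP[] //.
    by move=> _ /eqP.
lia.
Qed.
End Count.

Hypothesis balls : #|[set y | (y != x) && (d x y <= 3)]| = #|[set y | (y != x) && (e x y <= 3)]|.
Hypothesis bush : d v z = 7 -> #|[set y | (y != x) && (d y z == d y x + d x z)]|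
  <= #|[set y | (y != b3) && (d y v == d y b3 + d b3 v)]|.

Let far_split : d v z = 7 \/ exists b6, [/\ 8 <= d v z, d x b6 = 6 & d b6 z = d x z - 6].
Proof.
case: (ltngtP (d v z) 7) => h; [lia| |by left].
by right; geo Hd x z 6 b6; exists b6.
Qed.

(* The only other positions that [x] could take in [e] are excluded here and in
   [not_between_b1_b2]: distances at most 3 decide it when the path reaches a
   vertex at distance 6 from [x], and a count of the ball of [x] otherwise. *)
Lemma not_between_b2_b3 t : d x t = 1 -> t != b1 -> e t b1 = 1 -> e b1 b2 = 1 -> e b2 x = 1 -> e x b3 = 1 ->
  e t b2 = 2 -> (forall y, y != x -> (e b2 y <= 1) = (d b1 y <= 1)) -> False.
Proof.
move=> xt tb1 etb1 eb1b2 eb2x exb3 etb2 unit_ball_eq.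
have dtb1 := nd0 tb1; have tx : t != x by apply: nx; tlia.
have P1 y : 3 <= d x y -> d b1 y <= 3 -> e b1 y = 3 /\ e t y = 4.
  move=> h1 h2; have h3 := far_via h1; have yx : y != x by apply: nx; tlia.
  have dty : 4 <= d t y by quad Hd x t b1 y; tlia.
  have := K tx yx; have := K b1nx yx; tri He t b1 y; tlia.
have P2 y : 3 <= d x y -> d b1 y <= 3 -> d b3 y <= 3 -> e b2 y = 2.
  move=> h1 h2 h3; have [h4 h5] := P1 y h1 h2; have yx : y != x by apply: nx; tlia.
  have := K b3nx yx; have [h6 _] := P1 b3 ltac:(tlia) ltac:(tlia).
  by quad He b1 b2 b3 y; tri He b2 x b3; tlia.
have eb2b4 : e b2 b4 = 2 by apply: P2; tlia.
have [eb1b4 _] := P1 b4 ltac:(tlia) ltac:(tlia).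
have child c : c != x -> d b1 c <= 1 -> c != b1 -> c != b2 -> d c b4 = 4 /\ e b2 c = 1.
  move=> cx h /nd0 h1 h2; have := unit_ball_eq _ cx; have h3 := nd0 h2; have := ne0 h2.
  by sym2 He b2 c; quad Hd b1 b2 c b4; tlia.
have exb4 : e x b4 = 1.
  geo He b2 b4 1 r; have [<-//|rx] := eqVneq r x; first tlia.
  have rb1 : r != b1 by apply/eqP => E; move: dz0; rewrite E; tlia.
  have rb2 : r != b2 by apply/eqP => E; move: dz; rewrite E (tmxx He).
  have rle : d b1 r <= 1 by rewrite -unit_ball_eq // dz.
  by have [h _] := child r rx rle rb1 rb2; have := K rx b4nx; tlia.
(* [e] joins [b2] to [b4] through [x], so another neighbour [c] of [b1], being next to [b2] in [e],
   would be within 3 of [b4], whereas [d c b4 = 4]. *)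
have only c : c != x -> d b1 c <= 1 -> c = b1 \/ c = b2.
  move=> cx h; have [->|cb1] := eqVneq c b1; [by left|].
  have [->|cb2] := eqVneq c b2; [by right|].
  have [h1 h2] := child c cx h cb1 cb2; have := K cx b4nx.
  by quad He b2 x c b4; tlia.
have via y : 2 <= d b1 y -> 3 <= d x y -> d b2 y = d b1 y - 1.
  move=> h1 h2; have h3 := far_via h2; geo Hd b1 y 1 c.
  have cx : c != x by apply/eqP => E; move: dz dz0; rewrite E; tlia.
  have [E|E] := only c cx ltac:(tlia); move: dz dz0; rewrite E ?(tmxx Hd) //; tlia.
have via_x y : y != x -> 1 <= e b2 y -> e b1 y = (e b2 y).+1 -> e x y = e b2 y - 1.
  move=> yx h1 h2; geo He b2 y 1 r; have [<-//|rx] := eqVneq r x.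
  have rle : d b1 r <= 1 by rewrite -unit_ball_eq // dz.
  have [E|E] := only r rx rle; move: dz dz0; rewrite E ?(tmxx He) //; tlia.
have P3 y : 3 <= d x y -> d b1 y <= 3 -> e x y = 1.
  move=> h1 h2; have [h3 _] := P1 y h1 h2; have h5 := far_via h1; have h4 := via y ltac:(tlia) ltac:(tlia).
  have yx : y != x by apply: nx; tlia.
  have h6 : e b2 y = 2 by apply: P2 => //; tri Hd b2 b3 y; tlia.
  by rewrite via_x //; tlia.
(* With [b6] present, [b3] and [b4] are distinct [e]-neighbours of [x], and both would be nearer to
   [b6] than [x] is. *)
have [D_eq7|[b6 [D8 xb6 b6z]]] := far_split; last first.
  have b6nx : b6 != x by apply: nx; tlia.
  have h2 : d b2 b6 = 4 by rewrite on_geo; tlia.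
  have h3 : d b3 b6 = 3 by rewrite on_geo; tlia.
  have h4 : d b4 b6 = 2 by rewrite on_geo; tlia.
  have := K b2nx b6nx; have := K b3nx b6nx; have := K b4nx b6nx.
  have b34 : b3 != b4 by apply: neq; tlia.
  by have := ne0 b34; quad He x b3 b4 b6; tri He b2 x b6; tlia.
apply: (ball_count_contra D_eq7 balls (bush D_eq7) xt tb1); first by quad He t b2 x b1; tlia.
- move=> y yx h1 h2; have [->|yb1] := eqVneq y b1; first by tri He b1 b2 x; tlia.
  have := nd0 yb1; sym2 Hd b1 y => h3.
  have [h4|h4] := leqP (d b1 y) 1; last by rewrite P3; tri Hd x b1 y; tlia.
  have [E|E] := only y yx h4; first by rewrite E eqxx in yb1.
  by rewrite E; sym2 He b2 x; tlia.
- move=> y yb3 yv; have h1 := nd0 yb3; have h2 := dmax y v.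
  have h3 : d x y = d y b3 + 3 by quad Hd v x b3 y; tlia.
  have h4 := far_via (y := y) ltac:(tlia).
  have [h5|h5] := leqP (d b1 y) 3; first by rewrite P3; tlia.
  have h6 := via y ltac:(tlia) ltac:(tlia).
  have yx : y != x by apply: nx; tlia.
  have h7 := K b1nx yx; have h8 := K b2nx yx.
  have h9 : e b2 y = 3 /\ e b1 y = 4 by sym2 Hd v b3; tri He b1 b2 y; tlia.
  by rewrite via_x //; tlia.
Qed.

Lemma not_between_b1_b2 : e a1 b1 = 1 -> e b1 x = 1 -> e x b2 = 1 -> e x b3 = 2 -> False.
Proof.
move=> ea1b1 eb1x exb2 exb3.
have ea1x : e a1 x = 2.
  by have := ne0 a1nx; have := K a1nx b2nx; have := K a1nx b3nx; tri He a1 b1 x; tri He a1 x b2; tlia.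
have P1 y : 3 <= d x y -> d b1 y <= 3 -> e b1 y = 3 /\ e a1 y = 4.
  move=> h1 h2; have h3 := far_via h1; have yx : y != x by apply: nx; tlia.
  have day : 4 <= d a1 y by quad Hd x a1 b1 y; tlia.
  by have := K a1nx yx; have := K b1nx yx; tri He a1 b1 y; tlia.
have mid c : c != x -> d b1 c = 1 -> d x c = 2 -> e x c = 1.
  move=> cx h1 h2; have := K cx b3nx; have := K cx a1nx; have [_] := P1 b3 ltac:(tlia) ltac:(tlia).
  have xc : x != c by rewrite eq_sym.
  by have := ne0 xc; sym2 Hd a1 c; sym2 Hd b3 c; tri Hd b3 c b1; tri Hd a1 c b1; quad He a1 b3 x c; tlia.
have P2 y : 3 <= d x y -> d b1 y <= 3 -> e x y = 2.
  move=> h1 h2; have [h3 h4] := P1 y h1 h2; have h5 := far_via h1; geo Hd b1 y 1 c.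
  have yx : y != x by apply: nx; tlia.
  have h6 : d x c = 2 by tri Hd x b1 c; tri Hd x c y; tlia.
  have cx : c != x by apply: nx; tlia.
  have h7 := mid c cx dz h6; have := K cx yx.
  have b1c : b1 != c by apply: neq; tlia.
  by have := ne0 b1c; tri He b1 x c; quad He b1 x c y; tlia.
have b2child o : d x o = 4 -> d b3 o = 1 -> e b2 o = 1.
  move=> h1 h2; have h3 := far_via (y := o) ltac:(tlia); have exo := P2 o ltac:(tlia) ltac:(tlia).
  have [e1 e2] := P1 o ltac:(tlia) ltac:(tlia).
  have ox : o != x by apply: nx; tlia.
  geo He x o 1 c; have cx : c != x by apply/eqP => E; move: dz; rewrite E (tmxx He).
  have c1 : d c a1 <= 3 by rewrite K //; tri He a1 x c; tlia.
  have c2 : d c o <= 3 by rewrite K //; tlia.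
  have b1c : c != b1 by apply/eqP => E; move: dz0; rewrite E; tlia.
  have a1o : d a1 o = 5 by quad Hd a1 x b1 o; tlia.
  have b2o : d b2 o = 2 by quad Hd b1 b2 b3 o; tlia.
  have c3 := nd0 b1c.
  (* [a1] and [o] are 5 apart in [d], so their common cube-neighbours are [b1] and [b2], and
     [e c o = 1] rules out [b1]. *)
  suff E : c = b2 by rewrite -E; tlia.
  by apply: (tm_eq Hd) => //; quad Hd a1 o c b2; quad Hd a1 o c b1; tlia.
have e24 := b2child b4 xb4 b3b4.
have b34 : b3 != b4 by apply: neq; tlia.
have e34 := ne0 b34; have ex4 := P2 b4 ltac:(tlia) ltac:(tlia).
have e23 : e b2 b3 = 1.
  by have := K b3nx b4nx; quad He x b2 b3 b4; tlia.
have [D_eq7|[b6 [D8 xb6 b6z]]] := far_split; last first.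
  have b6nx : b6 != x by apply: nx; tlia.
  have h2 : d b2 b6 = 4 by rewrite on_geo; tlia.
  have h3 : d b3 b6 = 3 by rewrite on_geo; tlia.
  have h4 : d b4 b6 = 2 by rewrite on_geo; tlia.
  have := K b2nx b6nx; have := K b3nx b6nx; have := K b4nx b6nx.
  by quad He b2 b3 b4 b6; tlia.
have a1b1n : a1 != b1 by apply: neq; tlia.
have xa1 : d x a1 = 1 by sym2 Hd x a1; tlia.
apply: (ball_count_contra D_eq7 balls (bush D_eq7) xa1 a1b1n); first by sym2 He x a1; tlia.
- move=> y yx h1 h2; have [->|yb1] := eqVneq y b1; first by sym2 He b1 x; tlia.
  have := nd0 yb1; sym2 Hd b1 y => h3.
  have [h4|h4] := leqP (d b1 y) 1; first by rewrite mid //; tri Hd x b1 y; tlia.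
  by rewrite P2 //; tri Hd x b1 y; tlia.
- move=> y yb3 yv; have h1 := nd0 yb3; have h2 := dmax y v.
  have h3 : d x y = d y b3 + 3 by quad Hd v x b3 y; tlia.
  have h4 := far_via (y := y) ltac:(tlia).
  have [h5|h5] := leqP (d b1 y) 3; first by rewrite P2; tlia.
  have yx : y != x by apply: nx; tlia.
  have yb32 : d b3 y = 2 by sym2 Hd b3 y; sym2 Hd v b3; tlia.
  have h6 : d b2 y = 3 by quad Hd b1 b2 b3 y; tlia.
  geo Hd b3 y 1 o.
  have xo : d x o = 4 by tri Hd x b3 o; tri Hd x o y; tlia.
  have h7 := b2child o xo dz; have b3o : b3 != o by apply: neq; tlia.
  have ox : o != x by apply: nx; tlia.
  have := ne0 b3o; have := K b2nx yx; have := K b3nx yx; have := K ox yx.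
  by quad He b2 b3 o y; tri He x b2 y; tlia.
Qed.

(* The neighbours of [x] are the common cube-neighbours of [v] and [b2], so they
   form a closed neighbourhood for [e] too; its centre can only be [x]. *)
Lemma unit_ball_eq y : y != x -> (e x y <= 1) = (d x y <= 1).
Proof.
have ab : a1 != b1 by apply: neq; tlia.
have eab := ne0 ab; have xa1 : d x a1 = 1 by sym2 Hd x a1; tlia.
have /andP[c1 c2] : (e a1 v <= 3) && (e a1 b2 <= 3).
  by rewrite comm_vb2 //; sym2 Hd x a1; tlia.
have /andP[c3 c4] : (e b1 v <= 3) && (e b1 b2 <= 3).
  by rewrite comm_vb2 //; tlia.
have evb2 : 4 <= e v b2 by have := K vnx b2nx; tlia.
have [e31 e32] : e b1 b3 <= 3 /\ e a1 b3 >= 4.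
  by have := K b1nx b3nx; have := K a1nx b3nx; tlia.
have [e41 e42] : e b1 b4 <= 3 /\ e a1 b4 >= 4.
  by have := K b1nx b4nx; have := K a1nx b4nx; tlia.
have e43 : e b2 b4 <= 3 by have := K b2nx b4nx; tlia.
have e33 : e b2 b3 <= 3 by have := K b2nx b3nx; tlia.
(* The star of a midpoint again: [s] and [b3] are 4 apart in both metrics, with midpoint [b1] in [d]
   and [m] in [e]. *)
have comm_1 s : e s b3 = 4 -> s != x -> d s b1 = 2 -> d s b3 = 4 ->
    forall m, e s m = 2 -> e m b3 = 2 -> forall y, y != x -> (e m y <= 1) = (d b1 y <= 1).
  move=> h1 sx h2 h3 m h4 h5 u ux; have h6 := K sx ux; have h7 := K b3nx ux.
  by apply/idP/idP => h8; [tri He s m u; tri He b3 m u; quad Hd s b3 b1 u |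
    tri Hd s b1 u; tri Hd b3 b1 u; quad He s b3 m u]; tlia.
(* The common cube-neighbours [a1] and [b1] are distinct, so [e v b2] is below 6. At 4 the midpoint
   must be shown to be [x]; 5 is refuted. *)
have : e v b2 = 4 \/ e v b2 = 5.
  by tri He v a1 b2; tri He v b1 b2; quad He v b2 a1 b1; tlia.
case=> evb.
  geo He v b2 2 t.
  have tE u : u != x -> (e t u <= 1) = (d x u <= 1).
    move=> ux; rewrite -comm_vb2 //; sym2 He u v; sym2 He u b2.
    by apply/idP/idP => h; [tri He t u v; tri He t u b2 | quad He v b2 t u]; tlia.
  have [E|tx] := eqVneq t x; first by move=> yx; rewrite -(tE y yx) E.
  exfalso.
  have dxt : d x t = 1 by have := tE t tx; have := nxd tx; rewrite (tmxx He) //; tlia.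
  have etb1 : e t b1 <= 1 by rewrite tE //; tlia.
  have [E|tb1] := eqVneq t b1.
    have ea1b1 : e a1 b1 = 1 by have := tE a1 a1nx; rewrite E; sym2 He a1 b1; tlia.
    have eb13 : e b1 b3 = 3 by tri He a1 b1 b3; tlia.
    geo He b1 b3 1 r.
    have rx : r = x.
      apply/eqP/negPn/negP => rx.
      have h1 : d x r <= 1 by rewrite -tE // E dz1.
      have rb1 : r != b1 by apply/eqP => F; move: dz1; rewrite F (tmxx He).
      have := nd0 rb1; have := nxd rx; have := K rx b3nx; quad Hd x b1 b3 r; tlia.
    subst r; rewrite E in dz dz0.
    have eb1b2 : e b1 b2 = 2 by tlia.
    by apply: not_between_b1_b2 => //; quad He b1 x b2 b3; tlia.
  have dtb1 : d t b1 = 2 by have := nd0 tb1; tri Hd x t b1; tlia.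
  have dtb3 : d t b3 = 4 by quad Hd x t b1 b3; tlia.
  have etb1' : e t b1 = 1 by have := ne0 tb1; tlia.
  have et3 : e t b3 = 4 /\ e b1 b3 = 3 by have := K tx b3nx; tri He t b1 b3; tlia.
  have {et3} [et3 eb13] := et3.
  geo He t b3 2 m.
  have mE := comm_1 _ et3 tx dtb1 dtb3 m dz1 ltac:(tlia).
  have emb1 : e m b1 = 1 by have := mE b1 b1nx; rewrite (tmxx Hd) //; tri He t b1 m; tri He b1 m b3; tlia.
  have mb2 : b2 = m.
    have := mE b2 b2nx; apply: contra_eq => /ne0; tri He t m b2; sym2 He b2 m; tlia.
  subst m.
  geo He b2 b3 1 r.
  have [E|rx] := eqVneq r x.
    by subst r; apply: (not_between_b2_b3 dxt tb1) => //; sym2 He b1 b2; tlia.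
  have h1 : d b1 r <= 1 by rewrite -mE // dz3.
  have h2 : r != b2 by apply/eqP => F; move: dz3; rewrite F (tmxx He).
  have h3 : r != b1 by apply/eqP => F; move: dz4; rewrite F; tlia.
  have h4 := nd0 h2; have h5 := nd0 h3.
  have h6 : d r b4 = 4 by quad Hd b1 b2 r b4; tlia.
  have etb4 : d t b4 = 5 by quad Hd x t b1 b4; tlia.
  have := K tx b4nx; have := K rx b4nx; tri He t b1 b4; tri He b1 b2 b4; tri He b2 r b4; tlia.
exfalso.
have ea1b1 : e a1 b1 = 1 by quad He v b2 a1 b1; tlia.
have e_a1b3 : e a1 b3 = 4 /\ e b1 b3 = 3 by tri He a1 b1 b3; tlia.
have {e_a1b3} [ea13 eb13] := e_a1b3.
have [h1 h2] : e a1 b2 = 3 /\ e b1 b2 = 2.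
  by quad He a1 b1 b2 b3; quad He v b2 a1 b1; tlia.
geo He a1 b3 2 m.
have mE := comm_1 _ ea13 a1nx a1b1 a1b3 m dz ltac:(tlia).
have emb1 : e b1 m = 1 by quad He a1 b3 b1 m; tlia.
have emb2 : e m b2 = 1 by have := mE b2 b2nx; tri He b1 b2 m; tlia.
have [E|mx] := eqVneq m x; first by subst m; apply: not_between_b1_b2 => //; tlia.
have h3 : d b1 m <= 1 by rewrite -mE // (tmxx He).
have h4 : m != b1 by apply/eqP => F; move: emb1; rewrite F (tmxx He).
have h5 : m != b2 by apply/eqP => F; move: emb2; rewrite F (tmxx He).
have h6 := nd0 h4; have h7 := nd0 h5.
have h8 : d m b4 = 4 by quad Hd b1 b2 m b4; tlia.
have eb14 : e b1 b4 = 3 by tri He a1 b1 b4; tlia.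
by have := K mx b4nx; quad He b1 m b2 b4; tlia.
Qed.

End Gap.

(** * Exchanging twins *)

Lemma exchange_perm (V : finType) (x : V) (r : rel V) (n : nat) (A B : {set V}) :
    symmetric r -> (forall u u', r u u = r u' u') -> x \notin A -> x \notin B -> #|A| = #|B| ->
    #|A :\: B| = n ->
    (forall u u' y, u \in A :\: B -> u' \in B :\: A -> y != x -> y != u -> y != u' -> r y u = r y u') ->
  exists s : {perm V}, [/\ s x = x, forall y t, y != x -> t != x -> r (s y) (s t) = r y t
                         & forall y, (s y \in B) = (y \in A)].
Proof.
move=> rC rxx; elim: n A => [|n IHn] A xA xB eqc dAB tw.
  have/eqP AB : A == B.
    by rewrite eqEcard eqc leqnn andbT -setD_eq0 -cards_eq0 dAB.
  by exists 1%g; split=> [|y t _ _|y]; rewrite ?perm1 // AB.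
have dBA : #|B :\: A| = n.+1.
  by have := cardsID A B; have := cardsID B A; rewrite setIC; lia.
have /card_gt0P[u uAB] : 0 < #|A :\: B| by rewrite dAB.
have /card_gt0P[u' uBA] : 0 < #|B :\: A| by rewrite dBA.
have /setDP[uA uB] := uAB; have /setDP[u'B u'A] := uBA.
have neu : u != u' by apply: contraNneq u'A => <-.
have xu : x != u by apply: contraNneq xA => ->.
have xu' : x != u' by apply: contraNneq xB => ->.
(* One transposition of twins preserves [r] off [x] and moves [A] one element closer to [B]. *)
pose A1 := u' |: A :\ u.
have A1E y : (tperm u u' y \in A1) = (y \in A).
  rewrite !inE; case: tpermP => [->|->|/eqP yu /eqP yu'].
  - by rewrite eqxx uA.
  - by rewrite eqxx (negPf neu) (negPf u'A).
  - by rewrite (negPf yu) (negPf yu').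
have dA1 : A1 :\: B = (A :\: B) :\ u.
  apply/setP => y; rewrite !inE; have [->|_] /= := eqVneq y u'; last by rewrite andbCA.
  by rewrite u'B andbF.
have [|||||s [s1 s2 s3]] := IHn A1.
- by rewrite !inE (negPf xu') (negPf xA) andbF.
- exact: xB.
- by rewrite cardsU1 !inE (negPf u'A) andbF -eqc (cardsD1 u A) uA.
- by rewrite dA1; have := cardsD1 u (A :\: B); rewrite uAB dAB => -[].
- move=> w w'; rewrite dA1 => y /setD1P[_ h1] /setDP[h2 h3]; apply: tw => //.
  have wu : w' != u by apply: contraNneq uB => <-.
  by rewrite inE h2 andbT; apply: contra h3; rewrite !inE wu => ->; rewrite orbT.
exists (tperm u u' * s)%g; split=> [|y t yx tx|y]; rewrite ?permM.
- by rewrite tpermD 1?eq_sym.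
- have nx w : w != x -> tperm u u' w != x.
    by move=> wx; case: tpermP => // _; rewrite eq_sym.
  rewrite s2 ?nx //; case: (tpermP u u' y) => [->|->|/eqP h1 /eqP h2];
    case: (tpermP u u' t) => [->|->|/eqP h3 /eqP h4] //; rewrite ?(rxx u' u) //.
  + by rewrite [RHS]rC [LHS]rC (tw u u').
  + by rewrite [RHS]rC [LHS]rC (tw u u').
  + by rewrite (tw u u').
  + by rewrite (tw u u').
- by rewrite s3 A1E.
Qed.

Section TwinInclusion.
Variables (V : finType) (d e : V -> V -> nat) (x b1 : V).
Hypotheses (Hd : tmetric predT d) (He : tmetric predT e).
Hypothesis K : forall y t, y != x -> t != x -> (d y t <= 3) = (e y t <= 3).
Hypothesis ball : forall y, y != x -> [/\ (e x y <= 1) = (d x y <= 1),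
  (e x y <= 2) = (d x y <= 2), (e x y <= 4) = (d x y <= 4) & (e x y <= 5) = (d x y <= 5)].
Hypotheses (db1 : d x b1 = 1) (eb1 : e x b1 = 1).
Hypothesis via : forall y, 3 <= d x y <= 4 -> d b1 y = d x y - 1 /\ e b1 y = e x y - 1.

(** An inclusion only: the hypotheses are symmetric, so exchanging [d] with [e] and [u] with [u']
    gives the converse. In [e], [u'] hangs on the vertex [f] two steps from [x] towards [u]; the
    cases follow the depth of [y]. *)
Lemma twin_inclusion u u' y : d x u = 3 -> e x u = 4 -> d x u' = 4 -> e x u' = 3 ->
  y != x -> d y u <= 3 -> d y u' <= 3.
Proof.
move=> du eu du' eu'.
have nxd w : w != x -> 0 < d x w by move=> h; rewrite lt0n (tm0 Hd) // eq_sym.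
have nx w : 0 < d x w -> w != x by apply: contraL => /eqP->; rewrite (tmxx Hd).
have nxe w : 0 < e x w -> w != x by apply: contraL => /eqP->; rewrite (tmxx He).
have ux : u != x by apply: nx; tlia.
have u'x : u' != x by apply: nx; tlia.
have b1x : b1 != x by apply: nx; tlia.
have [dbu ebu] := via (y := u) ltac:(tlia).
have [dbu' ebu'] := via (y := u') ltac:(tlia).
geo He x u 2 f.
(* Were [u'] reached through another [f'], then [e f' u = 4], whereas [d] has [f'] and [u] within
   3. *)
have fu' : e f u' = 1.
  geo He x u' 2 f'.
  have [E|] := eqVneq f f'; first by rewrite E; tlia.
  rewrite -(tm0 He) // -lt0n => ff'.
  have f'x : f' != x by apply: nxe; tlia.
  have h8 : e b1 f' = 1 by quad He x u' f' b1; tlia.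
  have h9 : e b1 f = 1 by quad He x u f b1; tlia.
  have h10 : e f' u = 4 by quad He b1 f f' u; tlia.
  have xf' : d x f' = 2 by have [h1 h2 h3 h4] := ball f'x; tlia.
  have h5 := K f'x ux; have h6 := K f'x u'x.
  have h11 : d b1 f' = 1 by quad Hd x b1 f' u'; tlia.
  by tri Hd b1 f' u; tlia.
have P w : w != x -> 3 <= d x w <= 4 -> d w u <= 3 -> d w u' <= 3.
  move=> wx h1; rewrite !K //; have [h2 h3 h4 h5] := ball wx => h6.
  by quad He x u w f; tri He f w u'; tlia.
have P5 w : w != x -> d x w = 5 -> d w u <= 3 -> d w u' <= 3.
  move=> wx h1 h2; rewrite leqNgt; apply/negP => h3.
  have h0 : d u w = 2 by tri Hd x u w; tlia.
  geo Hd u w 1 o.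
  have xo : d x o = 4 by tri Hd x u o; tri Hd x o w; tlia.
  have ox : o != x by apply: nx; tlia.
  have h4 := P o ox ltac:(tlia); sym2 Hd o u.
  have h5 := h4 ltac:(tlia).
  by quad Hd x o w u'; tlia.
move=> yx; have [h1 h2 h3 h4] := ball yx; have h0 := nxd _ yx.
have [h5|h5] := leqP (d x y) 1; first by quad Hd x u y b1; tri Hd y b1 u'; tlia.
have [h6|h6] := leqP (d x y) 2.
  move=> h7; have := K yx ux; rewrite h7 => /esym h8; rewrite K //.
  by quad He x b1 y u; tri He y b1 u'; tlia.
have [h7|h7] := leqP (d x y) 4; first by apply: P => //; tlia.
have [h8|h8] := leqP (d x y) 5; first by apply: P5 => //; tlia.
move=> h9; have h10 : d x y = 6 /\ d u y = 3 by tri Hd x y u; tlia.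
have {h10} [h10 h11] := h10.
have := K yx ux; rewrite h9 => /esym h12.
have [h13|h13] : e x y = 6 \/ e x y = 7 by tri He x y u; tlia.
  have h14 : e u y = 2 by tri He x y u; tlia.
  geo He u y 1 w.
  have xw : e x w = 5 by tri He x u w; tri He x w y; tlia.
  have wx : w != x by apply: nxe; tlia.
  have [g1 g2 g3 g4] := ball wx.
  have g5 := P5 w wx ltac:(tlia); move: g5; rewrite K // K //; sym2 He u w => g5.
  have g6 := g5 ltac:(tlia).
  by rewrite K //; quad He x w u' y; tlia.
have h14 : e u y = 3 by tri He x y u; tlia.
(* Here [e x y = 7], and the distinct [u] and [o] would both be the vertex at distance 4 on the
   [e]-geodesic from [x] to [y]. *)
geo Hd u y 1 o.
have xo : d x o = 4 by tri Hd x u o; tri Hd x o y; tlia.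
have ox : o != x by apply: nx; tlia.
have [g1 g2 g3 g4] := ball ox; have g5 := K ox yx.
have : 0 < e u o by rewrite lt0n (tm0 He) // -(tm0 Hd) // -lt0n dz1.
by quad He x y u o; tlia.
Qed.

End TwinInclusion.

Lemma punctured_cube_perm (V : finType) (d e : V -> V -> nat) (x v z : V) :
    tmetric predT d -> tmetric predT e ->
    (forall y t, y != x -> t != x -> (d y t <= 3) = (e y t <= 3)) ->
    7 <= d v z -> d v x = 2 -> d x z = d v z - 2 -> (forall y t, d y t <= d v z) ->
    #|[set y | (y != x) && (d x y <= 3)]| = #|[set y | (y != x) && (e x y <= 3)]| ->
    (forall b3, d v z = 7 -> d x b3 = 3 -> d b3 z = d x z - 3 ->
      #|[set y | (y != x) && (d y z == d y x + d x z)]|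
        <= #|[set y | (y != b3) && (d y v == d y b3 + d b3 v)]|) ->
  exists s : {perm V}, [/\ s x = x,
    forall y t, y != x -> t != x -> (d (s y) (s t) <= 3) = (d y t <= 3)
    & forall y, y != x -> (e x (s y) <= 3) = (d x y <= 3)].
Proof.
move=> Hd He K D7 vx xz dmax balls bush.
geo Hd v x 1 a1; geo Hd x z 1 b1; geo Hd x z 2 b2; geo Hd x z 3 b3; geo Hd x z 4 b4.
have a1x : d a1 x = 1 by tlia.
have bush3 (h7 : d v z = 7) := bush b3 h7 dz5 dz6.
have hubE y : y != x -> (e x y <= 1) = (d x y <= 1).
  exact: (unit_ball_eq Hd He K D7 vx xz dmax dz a1x dz1 dz3 dz5 dz7 dz2 dz4 dz6 dz8 balls bush3).
have via y : 3 <= d x y -> d b1 y = d x y - 1.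
  exact: (far_via Hd D7 vx xz dmax dz a1x dz1 dz3 dz5 dz7 dz2 dz4 dz6 dz8).
have nxd w : w != x -> 0 < d x w by move=> h; rewrite lt0n (tm0 Hd) // eq_sym.
have nxe w : w != x -> 0 < e x w by move=> h; rewrite lt0n (tm0 He) // eq_sym.
have nx w : 0 < d x w -> w != x by apply: contraL => /eqP->; rewrite (tmxx Hd).
have nx' w : 0 < e x w -> w != x by apply: contraL => /eqP->; rewrite (tmxx He).
have a1nx : a1 != x by apply: nx; sym2 Hd x a1; tlia.
have b1nx : b1 != x by apply: nx; tlia.
have xa1 : d x a1 = 1 by sym2 Hd x a1; tlia.
have exa1 : e x a1 = 1 by have := nxe _ a1nx; have := hubE _ a1nx; tlia.
have exb1 : e x b1 = 1 by have := nxe _ b1nx; have := hubE _ b1nx; tlia.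
have a1b1 : d a1 b1 = 2 by quad Hd v z x b1; tri Hd v a1 b1; tri Hd x a1 b1; tlia.
have ea1b1 : e a1 b1 = 2.
  have : 0 < e a1 b1 by rewrite lt0n (tm0 He) // -(tm0 Hd) // -lt0n a1b1.
  by tri He x a1 b1; tlia.
(* The 2-ball consists of the common cube-neighbours of [a1] and [b1], and the 4- and 5-balls of the
   vertices within 3 of the 1- and 2-balls. The 3-ball has no such description, as it is the deleted
   adjacency of [x] itself. *)
have ball2 y : y != x -> (e x y <= 2) = (d x y <= 2).
  move=> yx; have k1 := K _ _ a1nx yx; have k2 := K _ _ b1nx yx.
  apply/idP/idP => h.
    by tri He x a1 y; tri He x b1 y; quad Hd a1 b1 x y; tlia.
  by tri Hd x a1 y; tri Hd x b1 y; quad He a1 b1 x y; tlia.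
have PE y : 3 <= d x y <= 4 -> e b1 y = e x y - 1 /\ e x y <= 4.
  move=> h; have yx : y != x by apply: nx; tlia.
  have h1 := via y ltac:(tlia); have k1 := K _ _ a1nx yx; have k2 := K _ _ b1nx yx.
  have h2 := ball2 y yx; have h3 : d a1 y = d x y + 1 by quad Hd a1 b1 x y; tlia.
  by quad He a1 b1 x y; tlia.
have ball4 y : y != x -> (e x y <= 4) = (d x y <= 4).
  move=> yx; apply/idP/idP => h; last first.
    have [h1|h1] := leqP (d x y) 2; first by have := ball2 y yx; tlia.
    by have [] := PE y ltac:(tlia).
  have h1 := nxe _ yx; geo He x y 1 n.
  have nnx : n != x by apply: nx'; tlia.
  by have := K _ _ nnx yx; have := hubE _ nnx; tri Hd x n y; tlia.
have ball5 y : y != x -> (e x y <= 5) = (d x y <= 5).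
  move=> yx; have h1 := ball4 y yx; apply/idP/idP => h.
    have [h2|h2] := leqP (e x y) 2; first by have := ball2 y yx; tlia.
    geo He x y 2 c; have cx : c != x by apply: nx'; tlia.
    by have := K _ _ cx yx; have := ball2 _ cx; tri Hd x c y; tlia.
  have [h2|h2] := leqP (d x y) 2; first by have := ball2 y yx; tlia.
  geo Hd x y 2 c; have cx : c != x by apply: nx; tlia.
  by have := K _ _ cx yx; have := ball2 _ cx; tri He x c y; tlia.
(* The balls of radius 3 about [x] may differ, but only by vertices which are twins
   away from [x]. *)
pose A := [set y | (y != x) && (d x y <= 3)]; pose B := [set y | (y != x) && (e x y <= 3)].
have dif u u' : u \in A :\: B -> u' \in B :\: A ->
    [/\ u != x, u' != x, d x u = 3, e x u = 4 & d x u' = 4 /\ e x u' = 3].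
  rewrite !inE => /andP[h1 /andP[ux h2]] /andP[h3 /andP[u'x h4]].
  rewrite ux /= -ltnNge in h1; rewrite u'x /= -ltnNge in h3.
  have := ball2 u ux; have := ball4 u ux; have := ball2 u' u'x; have := ball4 u' u'x.
  by split=> //; try split; tlia.
have balld y : y != x -> [/\ (e x y <= 1) = (d x y <= 1),
  (e x y <= 2) = (d x y <= 2), (e x y <= 4) = (d x y <= 4) & (e x y <= 5) = (d x y <= 5)].
  by move=> yx; split; [apply: hubE|apply: ball2|apply: ball4|apply: ball5].
have viad y : 3 <= d x y <= 4 -> d b1 y = d x y - 1 /\ e b1 y = e x y - 1.
  by move=> h; split; [apply: via; tlia | have [] := PE y h].
have [s [s1 s2 s3]] : exists s : {perm V}, [/\ s x = x,
    forall y t, y != x -> t != x -> (d (s y) (s t) <= 3) = (d y t <= 3)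
    & forall y, (s y \in B) = (y \in A)].
  apply: (@exchange_perm V x (fun y t => d y t <= 3) _ A B _ _ _ _ balls erefl).
  - by move=> y t; rewrite (tmC Hd).
  - by move=> u u'; rewrite !(tmxx Hd).
  - by rewrite inE eqxx.
  - by rewrite inE eqxx.
  move=> u u' y uA uB yx _ _; have [ux u'x h1 h2 [h3 h4]] := dif u u' uA uB.
  rewrite /=; apply/idP/idP => h5.
    exact: (twin_inclusion Hd He K balld dz1 exb1 viad h1 h2 h3 h4).
  rewrite K //; apply: (@twin_inclusion V e d x b1 He Hd _ _ exb1 dz1 _ u' u y) => //.
  - by move=> w w' wx w'x; rewrite K.
  - by move=> w wx; have [? ? ? ?] := balld w wx.
  - move=> w h; have wx : w != x by apply: nx'; tlia.
    by have := viad w; have := ball2 w wx; have := ball4 w wx => h6 h7 h8; have [] := h8 ltac:(tlia).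
  - by rewrite -K.
exists s; split=> // y yx; have := s3 y; rewrite !inE yx /=.
by rewrite -[in s y != x]s1 (inj_eq perm_inj) yx.
Qed.

(** * Kelly's lemma *)

Lemma isom_refl (G : sgraph) : isomorphic G G.
Proof. by apply/isomorphicP; exists id => //; exists id. Qed.

Lemma isom_sym (G H : sgraph) : isomorphic G H -> isomorphic H G.
Proof.
case/isomorphicP => f [g fK gK] fE; apply/isomorphicP; exists g; first by exists f.
by move=> x y; rewrite -fE !gK.
Qed.

Lemma isom_trans (G H K : sgraph) : isomorphic G H -> isomorphic H K -> isomorphic G K.
Proof.
case/isomorphicP => f fb fE /isomorphicP[g gb gE]; apply/isomorphicP; exists (g \o f).
  exact: bij_comp.
by move=> x y /=; rewrite gE fE.
Qed.

Definition isom_invariant (f : sgraph -> nat) := forall G H, isomorphic G H -> f G = f H.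

(* Both decks are grouped by a choice of representatives [rep] of the isomorphism
   classes among the cards of [G] and [H]. *)
Lemma deck_sum (G H : sgraph) (f : sgraph -> nat) : same_deck H G -> isom_invariant f ->
  \sum_(v : G) f (vdel v) = \sum_(w : H) f (vdel w).
Proof.
move=> HG fI; pose I := (G + H)%type.
pose card (i : I) := match i with inl v => vdel v | inr w => vdel w end.
pose rep i := odflt i [pick j | isomorphic (card i) (card j)].
have repP i : isomorphic (card i) (card (rep i)).
  by rewrite /rep; case: pickP => //= _; exact: isom_refl.
have rep_eq i j : isomorphic (card i) (card j) -> rep i = rep j.
  move=> ij; rewrite /rep (@eq_pick _ _ (fun l => isomorphic (card j) (card l))); last first.
    by move=> l; apply/idP/idP; [apply: isom_trans; exact: isom_sym | exact: isom_trans].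
  by case: pickP => // /(_ j); rewrite isom_refl.
have sumE (T : sgraph) (inj : T -> I) : (forall v, card (inj v) = vdel v) ->
    \sum_(v : T) f (vdel v) = \sum_(j : I) (rep j == j) * deck T (card j) * f (card j).
  move=> injE; rewrite (partition_big (rep \o inj) xpredT) //=; apply: eq_bigr => j _.
  rewrite (eq_bigr (fun _ => f (card j))) => [|v /eqP <-]; last first.
    by rewrite -injE; apply: fI; exact: repP.
  rewrite sum_nat_const; congr (_ * _).
  have [rj|rj] := eqVneq (rep j) j.
    rewrite mul1n /deck; apply: eq_card => v; rewrite !inE -injE [LHS]unfold_in /=.
    by apply/eqP/idP => [<-|/rep_eq -> //]; exact: repP.
  rewrite mul0n; apply: eq_card0 => v; rewrite unfold_in /=; apply: contraNF rj => /eqP E.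
  by rewrite -E; apply/eqP/esym/rep_eq; exact: repP.
rewrite (sumE G inl) // (sumE H inr) //; apply: eq_bigr => j _; by rewrite HG.
Qed.

Lemma same_deck_card (G H : sgraph) : same_deck H G -> #|G| = #|H|.
Proof.
move=> HG; have := deck_sum HG (f := fun=> 1) (fun _ _ _ => erefl).
by rewrite !sum1_card.
Qed.

(* [n_edges] counts every edge twice and [n_triangles] every triangle six times. *)
Definition deg (G : sgraph) (v : G) := \sum_(y : G) (adj v y : nat).
Definition n_edges (G : sgraph) := \sum_(x : G) deg x.
Definition triangles_at (G : sgraph) (v : G) := \sum_(y : G) \sum_(z : G) (adj v y * adj v z * adj y z).
Definition n_triangles (G : sgraph) := \sum_(x : G) triangles_at x.

Lemma isom_n_edges : isom_invariant n_edges.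
Proof.
move=> G H /isomorphicP[f fb fE]; rewrite /n_edges (reindex f) /=; last exact: onW_bij.
apply: eq_bigr => x _; rewrite /deg (reindex f) /=; last exact: onW_bij.
by apply: eq_bigr => y _; rewrite fE.
Qed.

Lemma isom_n_triangles : isom_invariant n_triangles.
Proof.
move=> G H /isomorphicP[f fb fE]; rewrite /n_triangles (reindex f) /=; last exact: onW_bij.
apply: eq_bigr => x _; rewrite /triangles_at (reindex f) /=; last exact: onW_bij.
apply: eq_bigr => y _; rewrite (reindex f) /=; last exact: onW_bij.
by apply: eq_bigr => z _; rewrite !fE.
Qed.

Lemma sum_vdel (G : sgraph) (v : G) (F : G -> nat) :
  \sum_(x : vdel v) F (val x) + F v = \sum_x F x.
Proof.
rewrite [RHS](bigD1 v) //= addnC; congr (_ + _).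
rewrite (reindex_omap (val : {x : G | x != v} -> G) insub) /= => [|x xv]; last by rewrite insubT.
by apply: eq_bigl => -[x xv] /=; rewrite insubT xv eqxx.
Qed.

Lemma n_edges_vdel (G : sgraph) (v : G) : n_edges (vdel v) + 2 * deg v = n_edges G.
Proof.
have E x : deg x = \sum_(y : vdel v) (adj x (val y) : nat) + adj x v.
  by rewrite /deg -(sum_vdel v).
rewrite {2}/n_edges -(sum_vdel v) /=.
under eq_bigr => x _ do rewrite E.
rewrite big_split /= -addnA; congr (_ + _); rewrite mul2n -addnn; congr (_ + _).
rewrite {1}/deg -(sum_vdel v) adj_irr addn0.
by apply: eq_bigr => x _; rewrite adj_sym.
Qed.

Lemma n_triangles_vdel (G : sgraph) (v : G) : n_triangles (vdel v) + 3 * triangles_at v = n_triangles G.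
Proof.
rewrite {2}/n_triangles -(sum_vdel v) /=.
have tauE x : triangles_at x = \sum_(y : vdel v) \sum_(z : vdel v)
      (adj x (val y) * adj x (val z) * adj (val y) (val z))
    + 2 * \sum_(y : vdel v) (adj x (val y) * adj x v * adj (val y) v).
  rewrite /triangles_at -(sum_vdel v) /=.
  under eq_bigr => y _ do rewrite -(sum_vdel v) /=.
  rewrite big_split /= -(sum_vdel v) /= adj_irr muln0 addn0 -addnA mul2n -addnn.
  congr (_ + (_ + _)); apply: eq_bigr => y _; by rewrite [adj v _]adj_sym [adj x v * _]mulnC.
under eq_bigr => x _ do rewrite tauE.
rewrite big_split /= -addnA; congr (_ + _).
rewrite [3 * _]mulSn [in RHS]addnC; congr (_ + _).
rewrite -big_distrr /=; congr (_ * _).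
rewrite /triangles_at -(sum_vdel v) /= [X in _ + X]big1 => [|z _]; last by rewrite adj_irr.
rewrite addn0; apply: eq_bigr => y _; rewrite -(sum_vdel v) adj_irr muln0 mul0n addn0.
by apply: eq_bigr => z _; rewrite ![adj v _]adj_sym mulnAC [adj _ v * adj _ _]mulnC.
Qed.

Definition simplicial (G : sgraph) (v : G) : bool :=
  [forall y, forall z, [&& adj v y, adj v z & y != z] ==> adj y z].

Lemma simplicialP (G : sgraph) (v : G) :
  reflect (forall y z, adj v y -> adj v z -> y != z -> adj y z) (simplicial v).
Proof.
apply: (iffP forallP) => [h y z vy vz yz|h y].
  by have /forallP/(_ z) := h y; rewrite vy vz yz.
by apply/forallP => z; apply/implyP => /and3P[]; exact: h.
Qed.

(** The square counts ordered pairs of neighbours: equal pairs give [deg v], adjacent pairs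
    [triangles_at v], and the rest is [bad]. Simpliciality thus becomes readable from a card. *)
Lemma simplicial_count (G : sgraph) (v : G) : simplicial v = (deg v * deg v == deg v + triangles_at v).
Proof.
pose bad := \sum_(y : G) \sum_(z : G) [&& adj v y, adj v z, y != z & ~~ adj y z].
have -> : deg v * deg v = deg v + triangles_at v + bad.
  rewrite {1 3}/deg big_distrl /= /triangles_at /bad -!big_split /=; apply: eq_bigr => y _.
  rewrite [X in _ = X + _ + _](_ : _ = \sum_(z : G) (adj v y * (y == z))); last first.
    by rewrite (bigD1 y) //= eqxx muln1 big1 ?addn0 // => z; rewrite eq_sym => /negPf->; rewrite muln0.
  rewrite -!big_split big_distrr /=.
  apply: eq_bigr => z _; have [<-|yz] := eqVneq y z; last first.
    by case: (adj v y); case: (adj v z); case: (adj y z).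
  by rewrite adj_irr; case: (adj v y).
rewrite -[X in _ == X]addn0 eqn_add2l /bad; apply/simplicialP/eqP => [h|/eqP h y z vy vz yz].
  rewrite big1 // => y _; rewrite big1 // => z _; apply/eqP; rewrite eqb0.
  by apply/negP => /and4P[vy vz yz /negP[]]; exact: h.
move: h; rewrite sum_nat_eq0 => /forallP/(_ y)/=; rewrite sum_nat_eq0 => /forallP/(_ z)/=.
by rewrite vy vz yz /= eqb0 negbK.
Qed.

Lemma same_deck_sym (G H : sgraph) : same_deck H G -> same_deck G H.
Proof. by move=> h K; rewrite h. Qed.

(** Summed over the cards, each edge survives in all but two of them, so the deck gives [#|G| - 2]
    times the count, and 3 vertices suffice to cancel. For triangles the factor is [#|G| - 3], hence
    the bound 4 there. *)
Lemma kelly_edges (G H : sgraph) : 3 <= #|G| -> same_deck H G -> n_edges H = n_edges G.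
Proof.
move=> G3 HG; have := deck_sum HG isom_n_edges; have := same_deck_card HG.
have E (K : sgraph) : \sum_(v : K) n_edges (vdel v) + 2 * n_edges K = #|K| * n_edges K.
  rewrite /n_edges -/(n_edges K) big_distrr /= -big_split /=.
  by under eq_bigr => v _ do rewrite -/(n_edges (vdel v)) n_edges_vdel; rewrite sum_nat_const.
by have := E G; have := E H; move=> h1 h2 h3 h4; nia.
Qed.

Lemma kelly_triangles (G H : sgraph) : 4 <= #|G| -> same_deck H G -> n_triangles H = n_triangles G.
Proof.
move=> G3 HG; have := deck_sum HG isom_n_triangles; have := same_deck_card HG.
have E (K : sgraph) : \sum_(v : K) n_triangles (vdel v) + 3 * n_triangles K = #|K| * n_triangles K.
  rewrite /n_triangles -/(n_triangles K) big_distrr /= -big_split /=.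
  by under eq_bigr => v _ do rewrite -/(n_triangles (vdel v)) n_triangles_vdel; rewrite sum_nat_const.
by have := E G; have := E H; move=> h1 h2 h3 h4; nia.
Qed.

Lemma card_match (G H : sgraph) (x : G) : 3 <= #|G| -> same_deck H G ->
  exists (psi : G -> H) (phi : H -> G), [/\ cancel psi phi, cancel phi psi,
    forall y z, y != x -> z != x -> adj (psi y) (psi z) = adj y z,
    deg (psi x) = deg x & 4 <= #|G| -> simplicial (psi x) = simplicial x].
Proof.
move=> G3 HG.
have : 0 < deck H (vdel x).
  by rewrite HG; apply/card_gt0P; exists x; rewrite inE; exact: isom_refl.
case/card_gt0P => x'; rewrite inE => iso; have/isomorphicP[f [g fK gK] fE] := iso.
(* [insub] fails only at the deleted vertex, and the default value pairs [x] with [x']. *)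
pose psi y := if insub y is Some u then val (g u) else x'.
pose phi y := if insub y is Some u then val (f u) else x.
have psix : psi x = x' by rewrite /psi insubF // eqxx.
have psiE y (yx : y != x) : psi y = val (g (Sub y yx)) by rewrite /psi insubT.
exists psi, phi; split.
- move=> y; have [->|yx] := eqVneq y x; first by rewrite psix /phi insubF // eqxx.
  by rewrite psiE /phi valK gK.
- move=> y; rewrite /phi; case: insubP => [u _ <-|]; first by rewrite /psi valK fK.
  by rewrite negbK => /eqP->.
- move=> y z yx zx; rewrite !psiE; set u := Sub y yx; set u' := Sub z zx.
  by have := fE (g u) (g u'); rewrite !gK => h; exact: esym h.
- rewrite psix; have := n_edges_vdel x'; have := n_edges_vdel x.
  by rewrite (isom_n_edges iso) (kelly_edges G3 HG) => <- /addnI/eqP; rewrite eqn_mul2l => /eqP.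
- move=> G4; rewrite !simplicial_count psix.
  have -> : deg x' = deg x.
    have := n_edges_vdel x'; have := n_edges_vdel x.
    by rewrite (isom_n_edges iso) (kelly_edges G3 HG) => <- /addnI/eqP; rewrite eqn_mul2l => /eqP.
  suff -> : triangles_at x' = triangles_at x by [].
  have := n_triangles_vdel x'; have := n_triangles_vdel x.
  by rewrite (isom_n_triangles iso) (kelly_triangles G4 HG) => <- /addnI/eqP; rewrite eqn_mul2l => /eqP.
Qed.

Lemma card_simplicial (G H : sgraph) : 4 <= #|G| -> same_deck H G ->
  #|[set v : H | simplicial v]| = #|[set v : G | simplicial v]|.
Proof.
move=> G4 HG; have G3 : 3 <= #|G| by exact: ltnW.
(* For [K = vdel v] the differences are [2 * deg v] and [3 * triangles_at v], so [f] tests from the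
   card whether the missing vertex is simplicial. *)
pose f (K : sgraph) : nat := let d := (n_edges G - n_edges K) %/ 2 in
  d * d == d + (n_triangles G - n_triangles K) %/ 3.
have fI : isom_invariant f by move=> K L KL; rewrite /f (isom_n_edges KL) (isom_n_triangles KL).
have E (K : sgraph) : n_edges K = n_edges G -> n_triangles K = n_triangles G ->
    #|[set v : K | simplicial v]| = \sum_(v : K) f (vdel v).
  move=> e1 e2; rewrite -sum1dep_card big_mkcond /=; apply: eq_bigr => v _.
  rewrite simplicial_count /f -e1 -e2 -(n_edges_vdel v) -(n_triangles_vdel v) !addKn !mulKn //.
rewrite (E G erefl erefl) (E H (kelly_edges G3 HG) (kelly_triangles G4 HG)).
by rewrite (deck_sum HG fI).
Qed.

(** * The path metric of a tree *)

(* The end of a longest simple path is a leaf. *)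
Lemma tree_leaf (T : sgraph) : tree T -> 1 < #|T| ->
  exists v p : T, adj v p /\ forall y, adj v y -> y = p.
Proof.
case=> [[_ conT]] acT /card_gt1P[x0 [x1 [_ _ x01]]].
have [x2 x02] : exists x2, adj x0 x2.
  have /connectP[[|y p] /= ] := conT x0 x1; first by move=> _ E; rewrite E eqxx in x01.
  by case/andP=> ? _ _; exists y.
pose P n := [exists p : n.-tuple T, path (@adj T) x0 p && uniq (x0 :: p)].
have exP : exists n, P n.
  exists 1; apply/existsP; exists [tuple x2]; rewrite /= x02 inE !andbT.
  by apply: contraTneq x02 => <-; rewrite adj_irr.
have bP n : P n -> n <= #|T|.
  case/existsP => p /andP[_ /card_uniqP E]; apply: ltnW.
  by have := max_card [in x0 :: p]; rewrite E /= size_tuple.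
case: (ex_maxnP exP bP) => n Pn maxn; have [p /andP[xp up]] := existsP Pn.
have n0 : 0 < n.
  apply: (maxn 1); apply/existsP; exists [tuple x2]; rewrite /= x02 inE !andbT.
  by apply: contraTneq x02 => <-; rewrite adj_irr.
have : size p = n by rewrite size_tuple.
case/lastP: (tval p) xp up => [|q z]; first by move=> _ _ E; rewrite -E in n0.
rewrite rcons_path => /andP[xq qz] uq szq.
exists z, (last x0 q); rewrite adj_sym; split=> // y zy.
have [yq|yq] := boolP (y \in x0 :: q); last first.
  have zy' : y != z by apply: contraTneq zy => ->; rewrite adj_irr.
  have sz : size (rcons (rcons q z) y) == n.+1 by rewrite size_rcons szq.
  have /maxn : P n.+1; last by rewrite ltnn.
  have uq' : uniq (x0 :: rcons (rcons q z) y).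
    by rewrite -rcons_cons rcons_uniq uq andbT -rcons_cons mem_rcons inE negb_or zy' yq.
  by apply/existsP; exists (Tuple sz); rewrite uq' andbT /= !rcons_path xq qz last_rcons zy.
have [p1 [p2 E]] : exists p1 p2, x0 :: q = p1 ++ y :: p2.
  by case/splitPr: yq => p1 p2; exists p1, p2.
have s1 : sorted (@adj T) (p1 ++ y :: rcons p2 z).
  by rewrite -[p1 ++ _]/(p1 ++ rcons (y :: p2) z) -rcons_cat -E /= rcons_path xq.
have u1 : uniq (p1 ++ y :: rcons p2 z).
  by rewrite -[p1 ++ _]/(p1 ++ rcons (y :: p2) z) -rcons_cat -E rcons_cons.
have : size (y :: rcons p2 z) <= 2.
  apply: acT; apply/andP; split; last by move: u1; rewrite cat_uniq => /and3P[].
  by rewrite /= rcons_path last_rcons zy andbT; have [] := cat_sorted2 s1.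
rewrite /= size_rcons; case: p2 E {s1 u1} => // E _.
by rewrite -[last x0 q]/(last x0 (x0 :: q)) E last_cat.
Qed.

Lemma tree_vdel (T : sgraph) (v p : T) : tree T -> adj v p -> (forall y, adj v y -> y = p) ->
  tree (vdel v).
Proof.
case=> [[_ conT]] acT vp only.
have pv : p != v by apply: contraTneq vp => ->; rewrite adj_irr.
split; last first.
  move=> c /andP[cc uc]; rewrite -(size_map val); apply: acT; apply/andP; split.
    by rewrite cycle_map.
  by rewrite map_inj_uniq //; exact: val_inj.
split; first by apply/card_gt0P; exists (Sub p pv).
(* [r] folds the leaf [v] onto [p], the default of [insubd]; an edge goes to an edge or to a single
   vertex, so walks survive. *)
pose r (x : T) : vdel v := insubd (Sub p pv) x.
have rE (x : vdel v) : r (val x) = x by rewrite /r valKd.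
have rv : r v = Sub p pv by rewrite /r /insubd insubF // eqxx.
suff con x y : connect (@adj T) x y -> connect (@adj (vdel v)) (r x) (r y).
  by move=> x y; rewrite -[x]rE -[y]rE; apply: con; exact: conT.
case/connectP => q; elim: q x => [|t q IH] x /=; first by move=> _ ->.
case/andP => xt tq E; apply: connect_trans (IH t tq E).
have [xv|xv] := eqVneq x v.
  by move: xt; rewrite xv => /only ->; rewrite rv -[p]/(val (Sub p pv : vdel v)) rE.
have [tv|tv] := eqVneq t v.
  move: xt; rewrite tv adj_sym => /only ->.
  by rewrite rv -[p in r p]/(val (Sub p pv : vdel v)) rE.
apply: connect1; rewrite /r /insubd !insubT; exact: xt.
Qed.

Lemma tree_tmetric (T : sgraph) : tree T ->
  exists d, tmetric predT d /\ forall x y : T, adj x y = (d x y == 1).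
Proof.
have [n] := ubnP #|T|; elim: n T => // n IHn T leTn trT.
have [le1|gt1] := leqP #|T| 1.
  have all_eq (x y : T) : x = y by apply: (card_le1_eqP le1).
  exists (fun _ _ => 0); split=> [|x y]; last by rewrite (all_eq x y) adj_irr.
  split=> //; first by move=> x y _ _; rewrite (all_eq x y) !eqxx.
  by move=> x y k _ _; rewrite leqn0 => /eqP->; exists x.
have [v [p [vp only]]] := tree_leaf trT gt1.
have [|d [Hd dE]] := IHn (vdel v) _ (tree_vdel trT vp only).
  apply: leq_trans (leTn : #|T| <= n); rewrite card_sig /=.
  by rewrite (cardD1 v) inE add1n ltnS subset_leq_card //; apply/subsetP => x; rewrite !inE andbT.
have pv : p != v by apply: contraTneq vp => ->; rewrite adj_irr.
pose d1 (x y : T) := if (insub x, insub y) is (Some a, Some b) then d (a : vdel v) b else 0.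
have d1E x y (xv : x != v) (yv : y != v) : d1 x y = d (Sub x xv) (Sub y yv).
  by rewrite /d1 !insubT.
have H1 : tmetric (predC1 v) d1.
  split.
  - by move=> x y xv yv; rewrite d1E (tm0 Hd).
  - by move=> x y xv yv; rewrite !d1E (tmC Hd).
  - by move=> x y z xv yv zv; rewrite !d1E; apply: (tmP Hd).
  - by move=> x y z t xv yv zv tv; rewrite !d1E; apply: (tm4 Hd).
  - move=> x y k xv yv; rewrite d1E => lek.
    have [z [_ h1 h2]] :=
      tmG Hd (isT : Sub x xv \in predT) (isT : Sub y yv \in predT) lek.
    have zv : val z != v := valP z; have zE : Sub (val z) zv = z by apply: val_inj.
    by exists (val z); rewrite (d1E _ _ xv zv) (d1E _ _ zv yv) zE.
exists (leaf_ext v p d1); split; first by apply: (leaf_ext_tmetric H1) => [||x]; rewrite !inE ?eqxx // orbN.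
move=> x y; rewrite /leaf_ext; have [->|xv] := eqVneq x v; have [->|yv] := eqVneq y v.
- by rewrite adj_irr.
- rewrite eqSS (tm0 H1) //; apply/idP/eqP => [/only ->//|<-//].
- by rewrite eqSS (tm0 H1) // adj_sym; apply/idP/eqP => [/only ->//|->//].
- by rewrite d1E -dE.
Qed.

Lemma cube_tmetric (T : sgraph) : tree T ->
  exists d, tmetric predT d /\ forall x y : power 3 T, adj x y = (x != y) && (d x y <= 3).
Proof.
case/tree_tmetric => d [Hd dE]; exists d; split=> // x y.
suff distE : @dist T x y = Some (d x y) by rewrite /= /power_adj distE.
apply/dist_SomeP; split.
  have [n] := ubnP (d x y); elim: n x => // n IHn x len.
  have [E|xy] := eqVneq x y.
    by rewrite E (tmxx Hd) //; apply/existsP; exists [tuple]; rewrite /= eqxx.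
  have dpos : 0 < d x y by rewrite lt0n (tm0 Hd).
  geo Hd x y 1 t; have /existsP[p /andP[tp lp]] := IHn t ltac:(lia).
  have sz : size (t :: p) == d x y by rewrite /= size_tuple dz0; lia.
  by apply/existsP; exists (Tuple sz); rewrite /= dE dz eqxx tp.
suff len (q : seq T) (t : T) : path (@adj T) t q -> d t (last t q) <= size q.
  by move=> n /existsP[p /andP[xp /eqP <-]]; apply: leq_trans (len _ _ xp) _; rewrite size_tuple.
elim: q t => [|t q IH] {}x /=; first by rewrite (tmxx Hd).
by case/andP; rewrite dE => /eqP xt /IH h; tri Hd x t (last t q); lia.
Qed.

(** * Reconstruction *)

Definition cube_of (G : sgraph) (d : G -> G -> nat) := forall x y, adj x y = (x != y) && (d x y <= 3).

(** The reflexive closure, which for the cube of a metric [d] is exactly [d x y <= 3]. *)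
Definition cladj (G : sgraph) : rel G := fun x y => (x == y) || adj x y.

Lemma cladj_refl (G : sgraph) : reflexive (@cladj G).
Proof. by move=> x; rewrite /cladj eqxx. Qed.

Lemma cladj_sym (G : sgraph) : symmetric (@cladj G).
Proof. by move=> x y; rewrite /cladj eq_sym adj_sym. Qed.

Lemma cladj_adj (G : sgraph) (x y : G) : adj x y = (x != y) && cladj x y.
Proof. by rewrite /cladj; case: eqVneq => //= ->; rewrite adj_irr. Qed.

Lemma simplicial_cladj (G : sgraph) (v : G) :
  reflect (forall y z, cladj v y -> cladj v z -> cladj y z) (simplicial v).
Proof.
apply: (iffP (simplicialP v)) => [h y z|h y z vy vz yz].
  rewrite /cladj => /orP[/eqP E|vy] /orP[/eqP F|vz].
  - by rewrite -E -F eqxx.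
  - by rewrite -E vz orbT.
  - by rewrite -F adj_sym vy orbT.
  - by have [//|yz] := eqVneq y z; rewrite h.
by have := h y z; rewrite /cladj vy vz !orbT (negPf yz) => /(_ isT isT).
Qed.

Lemma deg_card (G : sgraph) (v : G) : deg v = #|[set y | adj v y]|.
Proof. by rewrite /deg -sum1dep_card [RHS]big_mkcond /=; apply: eq_bigr => y _; case: (adj v y). Qed.

Lemma deg_dominating (G : sgraph) (v : G) : (forall y, y != v -> adj v y) <-> deg v = #|G|.-1.
Proof.
have sub : [set y | adj v y] \subset [set~ v].
  by apply/subsetP => y; rewrite !inE; apply: contraTneq => ->; rewrite adj_irr.
rewrite deg_card -[#|G|.-1](cardsC1 v); split=> [h|E].
  apply: eq_card => y; rewrite !inE; have [->|/h ->//] := eqVneq y v; exact: adj_irr.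
have/eqP eqS : [set y | adj v y] == [set~ v] by rewrite eqEcard sub E leqnn.
by move=> y yv; have : y \in [set~ v] by [rewrite !inE]; rewrite -eqS inE.
Qed.

(** The degree forces [psi c] to dominate [H], so the bijection extending the card isomorphism
    respects the edges at [c] too. *)
Lemma dominating_reconstruct (G H : sgraph) (c : G) : 3 <= #|G| -> same_deck H G ->
  (forall y, y != c -> adj c y) -> isomorphic H G.
Proof.
move=> G3 HG dom; have [psi [phi [psiK phiK psiE degE _]]] := card_match c G3 HG.
have dom' : forall y, y != psi c -> adj (psi c) y.
  by apply/deg_dominating; rewrite degE -(same_deck_card HG); apply/deg_dominating.
apply/isom_sym/isomorphicP; exists psi; first by exists phi.
have inj := can_inj psiK.
move=> x y; have [->|xc] := eqVneq x c; have [->|yc] := eqVneq y c.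
- by rewrite !adj_irr.
- by rewrite dom ?dom' ?(inj_eq inj).
- by rewrite ![adj _ c]adj_sym ![adj _ (psi c)]adj_sym dom ?dom' ?(inj_eq inj).
- exact: psiE.
Qed.

(** * Trees of diameter at least 7 *)

Section LargeDiameter.
Variables (G H : sgraph) (d : G -> G -> nat) (a b : G).
Hypotheses (Hd : tmetric predT d) (dE : cube_of d) (HG : same_deck H G).
Hypotheses (dab : 7 <= d a b) (dmax : forall y t, d y t <= d a b).

Let kE (y t : G) : cladj y t = (d y t <= 3).
Proof.
by rewrite /cladj dE -(tm0 Hd) //; case: (d y t) => [|n] //=.
Qed.

Let nodom (h : G) : exists y, ~~ cladj h y.
Proof.
have [ha|ha] := leqP (d h a) 3; last by exists a; rewrite kE -ltnNge.
by exists b; rewrite kE -ltnNge; tri Hd h a b; tlia.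
Qed.

Let G4 : 4 <= #|G|.
Proof.
geo Hd a b 1 p; geo Hd a b 2 q.
have u : uniq [:: a; p; q; b].
  rewrite /= !inE !negb_or -!(tm0 Hd) // dz dz1 dz2 dz0.
  by have := tm_eq Hd; tri Hd a p q; tlia.
by have := max_card [in [:: a; p; q; b]]; rewrite (card_uniqP u).
Qed.
Let G3 : 3 <= #|G|. Proof. exact: ltnW. Qed.

Let simp_metric v : simplicial v -> tmetric (predC1 v) d.
Proof.
move=> sv; have [z nz] := nodom v.
have [p [_ vp vP]] : exists p,
    [/\ p \in predT, d v p = 1 & forall y, y \in predT -> y != v -> d v y = (d p y).+1].
  apply: (simplicial_leaf Hd (z := z)) => //; first by rewrite ltnNge -kE.
  by move=> y t _ _; rewrite -!kE; exact/simplicial_cladj.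
apply: (sub_tmetric Hd) => // x y z' xv yv _ E; rewrite inE; apply/eqP => F.
rewrite !inE in xv yv; move: E; rewrite F (tmC Hd) // !vP //; tri Hd x y p; tlia.
Qed.

Let nodomH (h : H) : exists y, ~~ cladj h y.
Proof.
have cGH := same_deck_card HG.
suff /existsP[y ny] : [exists y, ~~ cladj h y] by exists y.
rewrite -negb_forall; apply/negP => /forallP all.
have HG' := same_deck_sym HG.
have [|psi [phi [psiK phiK psiE degE _]]] := @card_match H G h _ HG'; first by rewrite -cGH.
have [y] := nodom (psi h); rewrite /cladj negb_or => /andP[n1]; apply/negP; rewrite negbK.
have : forall y, y != psi h -> adj (psi h) y.
  apply/deg_dominating; rewrite degE cGH; apply/deg_dominating => t th.
  by have := all t; rewrite /cladj eq_sym (negPf th).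
by apply; rewrite eq_sym.
Qed.

Let cladj_iso (x : G) (psi : G -> H) (phi : H -> G) : cancel psi phi -> cancel phi psi ->
    (forall y z, y != x -> z != x -> adj (psi y) (psi z) = adj y z) ->
  forall y t, y != psi x -> t != psi x -> (d (phi y) (phi t) <= 3) = cladj y t.
Proof.
move=> psiK phiK psiE y t yx tx; rewrite -kE /cladj (can_eq phiK); congr (_ || _).
by rewrite -psiE ?phiK // -(can_eq psiK) phiK.
Qed.

Let transport (x : G) (psi : G -> H) (phi : H -> G) : cancel psi phi -> cancel phi psi -> simplicial x ->
  tmetric (predC1 (psi x)) (fun y t => d (phi y) (phi t)).
Proof.
move=> psiK phiK sx; apply: (perm_tmetric phiK psiK _ (simp_metric sx)).
by move=> y; rewrite !inE (can2_eq phiK psiK).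
Qed.

Let metric_off (u : H) : simplicial u ->
  exists T, tmetric (predC1 u) T /\ forall y t, y != u -> t != u -> (T y t <= 3) = cladj y t.
Proof.
have cGH := same_deck_card HG; have HG' := same_deck_sym HG.
move=> su; have [|psi [phi [psiK phiK psiE _ sE]]] := @card_match H G u _ HG'; first by rewrite -cGH.
have sp : simplicial (psi u) by rewrite sE // -cGH.
exists (fun y t => d (psi y) (psi t)); split; first by rewrite -{1}(psiK u); exact: transport.
rewrite -{1 2}(psiK u); apply: cladj_iso => // y z yu zu.
by rewrite -psiE ?phiK // (can2_eq phiK psiK).
Qed.

Let first_card : exists w S, [/\ simplicial w, tmetric (predC1 w) S,
  forall y t : H, y != w -> t != w -> (S y t <= 3) = cladj y t &
  spread (@cladj H) w S].
Proof.
have base v : simplicial v -> exists psi phi, [/\ cancel psi phi, simplicial (psi v),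
    tmetric (predC1 (psi v)) (fun y t => d (phi y) (phi t)) &
    forall y t : H, y != psi v -> t != psi v -> (d (phi y) (phi t) <= 3) = cladj y t].
  move=> sv; have [psi [phi [psiK phiK psiE _ sE]]] := card_match v G3 HG.
  exists psi, phi; split=> //; [by rewrite sE|exact: transport|exact: cladj_iso].
have [/existsP[v /and3P[sv va vb]]|none] := boolP [exists v, [&& simplicial v, v != a & v != b]].
  have [psi [phi [psiK sw HS KS]]] := base v sv.
  exists (psi v), (fun y t => d (phi y) (phi t)); split=> //; left.
  by exists (psi a), (psi b); rewrite !psiK !(can_eq psiK) eq_sym va eq_sym vb.
have sa : simplicial a by apply/simplicial_cladj => y t; rewrite !kE; apply: (end_simplicial Hd (b := b)).
have [psi [phi [psiK sw HS KS]]] := base a sa.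
exists (psi a), (fun y t => d (phi y) (phi t)); split=> //; right; split.
  geo Hd a b 1 p; exists (psi p), (psi b); rewrite !psiK !(can_eq psiK); split; last by tlia.
    by rewrite -(tm0 Hd) // (tmC Hd) // dz.
  by rewrite -(tm0 Hd) // (tmC Hd) //; case: (d a b) dab.
move=> y t yw tw yt /simplicial_cladj sy /simplicial_cladj st.
(* [H] has as many simplicial vertices as [G], whose only ones are among [a] and [b]; a third is
   impossible. *)
have : #|[set psi a; y; t]| <= #|[set v : H | simplicial v]|.
  by apply/subset_leq_card/subsetP => z; rewrite !inE => /orP[/orP[]|] /eqP->.
rewrite (card_simplicial G4 HG); apply/negP; rewrite -ltnNge.
have -> : #|[set psi a; y; t]| = 3.
  by rewrite setUC cardsU1 cards2 !inE negb_or tw eq_sym yt eq_sym yw.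
have : [set v : G | simplicial v] \subset [set a; b].
  apply/subsetP => v; rewrite !inE => sv; apply: contraNT none; rewrite negb_or => /andP[va vb].
  by apply/existsP; exists v; rewrite sv va.
by move/subset_leq_card; rewrite cards2; case: (a != b) => /leq_ltn_trans; apply.
Qed.

Lemma cube_recognition : exists e, tmetric predT e /\ forall y t : H, (e y t <= 3) = cladj y t.
Proof.
have [w [S [sw HS KS large]]] := first_card.
have ksw := simplicial_cladj _ sw.
have [u [b' [[uw bw] kwu [Sb Smax] far_u far_simp]]] := choose_far_end (@cladj_sym H) HS KS ksw large.
(* [u] is not adjacent to [w], so its neighbourhood lies in the card, where [u] ends a diametral
   path. *)
have ksu : forall y t, cladj u y -> cladj u t -> cladj y t.
  have off y : cladj u y -> y != w by apply: contraTneq => ->; rewrite cladj_sym.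
  move=> y t uy ut; have yw := off _ uy; have tw := off _ ut.
  rewrite -KS //; apply: (end_simplicial HS (a := u) (b := b')); rewrite ?inE ?KS //.
have su : simplicial u by exact/simplicial_cladj.
have [T [HT KT]] := metric_off su.
apply: (glue_metrics (@cladj_refl H) (@cladj_sym H) HS HT KS KT _ kwu ksw ksu nodomH far_u far_simp
  bw Sb Smax).
by rewrite eq_sym.
Qed.

Let end_card_isom v z x : d v z = d a b -> d v x = 2 -> d x z = d v z - 2 ->
  (forall b3, d v z = 7 -> d x b3 = 3 -> d b3 z = d x z - 3 ->
    #|[set y | (y != x) && (d y z == d y x + d x z)]| <=
    #|[set y | (y != b3) && (d y v == d y b3 + d b3 v)]|) ->
  isomorphic H G.
Proof.
move=> dvz dvx dxz bush; have [e0 [He0 eE]] := cube_recognition.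
have [psi [phi [psiK phiK psiE degE _]]] := card_match x G3 HG.
pose e y t := e0 (psi y) (psi t).
have He : tmetric predT e by apply: (perm_tmetric psiK phiK _ He0) => y; rewrite !inE.
have adjH y t : adj (psi y) (psi t) = (y != t) && (e y t <= 3).
  by rewrite cladj_adj -eE (can_eq psiK).
have K y t : y != x -> t != x -> (d y t <= 3) = (e y t <= 3).
  by move=> yx tx; rewrite -kE /e eE /cladj (can_eq psiK) psiE.
have balls : #|[set y | (y != x) && (d x y <= 3)]| = #|[set y | (y != x) && (e x y <= 3)]|.
  transitivity (deg x).
    by rewrite deg_card; apply: eq_card => y; rewrite !inE dE eq_sym.
  rewrite -degE /deg (reindex psi) /=; last by exists phi => y _.
  rewrite -sum1dep_card [RHS]big_mkcond /=; apply: eq_bigr => y _.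
  by rewrite adjH eq_sym; case: (_ && _).
have dvz7 : 7 <= d v z by rewrite dvz.
have vmax y t : d y t <= d v z by rewrite dvz.
have [s [sx sd sxE]] := punctured_cube_perm Hd He K dvz7 dvx dxz vmax balls bush.
apply/isom_sym/isomorphicP; exists (psi \o s).
  by apply: bij_comp; [exists phi | exists (s^-1)%g; [exact: permK | exact: permKV]].
have sxN y : y != x -> s y != x by rewrite -{2}sx (inj_eq perm_inj).
move=> y t /=; rewrite adjH dE (inj_eq perm_inj); have [//|yt /=] := eqVneq y t.
have [yx|yx] := eqVneq y x.
  by rewrite yx sx sxE // eq_sym -yx.
have [tx|tx] := eqVneq t x.
  by rewrite tx sx (tmC He) // sxE // (tmC Hd).
by rewrite -K ?sxN // sd.
Qed.

(** At diameter 7 the vertices 2 steps from the two ends are 3 apart, so each is the [b3] of the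
    other; reading the path from the end with the smaller bush supplies the hypothesis on bushes. *)
Lemma large_diameter_reconstruct : isomorphic H G.
Proof.
sym2 Hd a b; geo Hd a b 2 x; geo Hd b a 2 x2; sym2 Hd a x2; sym2 Hd b x.
have dx2 : d a b = 7 -> d x x2 = 3 by move=> E; quad Hd a b x x2; tlia.
have [le|/ltnW le] := leqP #|[set y | (y != x) && (d y b == d y x + d x b)]|
  #|[set y | (y != x2) && (d y a == d y x2 + d x2 a)]|.
  apply: (end_card_isom (v := a) (z := b) (x := x)) => // b3 E h1 h2.
  suff -> : b3 = x2 by [].
  by apply: (tm_eq Hd) => //; quad Hd x b b3 x2; have := dx2 E; tlia.
apply: (end_card_isom (v := b) (z := a) (x := x2)) => // b3 E h1 h2.
suff -> : b3 = x by [].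
have E' : d a b = 7 by tlia.
by apply: (tm_eq Hd) => //; quad Hd x2 a b3 x; have := dx2 E'; tlia.
Qed.
End LargeDiameter.

Theorem theorem4p1 (G : sgraph) (G_ge3 : 3 <= #|G|)
    (G_cube : exists T : sgraph, tree T /\ isomorphic G (power 3 T)) :
  forall H : sgraph, same_deck H G -> isomorphic H G.
Proof.
move=> H HG; have [T [treeT /isomorphicP[f [g fK gK] fE]]] := G_cube.
have [d0 [Hd0 dE0]] := cube_tmetric treeT.
pose d x y := d0 (f x) (f y).
have Hd : tmetric predT d by apply: (perm_tmetric fK gK _ Hd0) => x; rewrite !inE.
have dE : cube_of d by move=> x y; rewrite -fE dE0 (can_eq fK).
have /card_gt0P[x0 _] : 0 < #|G| by apply: leq_trans G_ge3.
have [a [b [_ _ mx]]] := tmetric_ends d (isT : x0 \in predT) (isT : x0 \in predT).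
have dmax y t : d y t <= d a b by exact: mx.
have [small|large] := leqP (d a b) 6; last exact: (large_diameter_reconstruct Hd dE HG large).
(* The rounded midpoint is within 3 of every vertex: from one at distance 4 an end of the path would
   be farther than [d a b]. *)
geo Hd a b (d a b %/ 2) c.
apply: (dominating_reconstruct (c := c) G_ge3 HG) => y yc; rewrite dE eq_sym yc /=.
have := dmax y a; have := dmax y b; sym2 Hd y a; sym2 Hd y b.
by quad Hd a b c y; tlia.
Qed.
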